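(* For any $q\in\tfrac{1}{2}\mathbb{Z}\setminus\mathbb{Z}_{\leq 0}$ and every integer $N\geq 1$, \[ \delta_{q}(N)\;\geq\;\frac{\max\left\{0,\left\lceil \sqrt{2\lfloor N/2\rfloor+9/4}-5/2\right\rceil\right\}}{N}\;\geq\;\frac{\max\left\{0,\sqrt{N}-5/2\right\}}{N}=:\beta(N), \] where $\beta(N)\asymp N^{-1/2}$ as $N\to\infty$.
   Context: $\Gamma$ denotes the Euler Gamma function (meromorphically continued, so that it is analytic at every real point outside $\mathbb{Z}_{\leq 0}=\{0,-1,-2,\ldots\}$), and $\Gamma^{(n)}(q)$ denotes its $n$-th derivative evaluated at $q$. The set $\tfrac{1}{2}\mathbb{Z}=\{k/2: k\in\mathbb{Z}\}$. A number is transcendental if it is not algebraic over $\mathbb{Q}$. For fixed $q$ and an integer $N\geq 1$, \[ \delta_{q}(N)=\frac{\#\left\{1\leq n\leq N:\ \Gamma^{(n)}(q)\text{ is transcendental}\right\}}{N} \] is the density of indices $n\in\{1,2,\ldots,N\}$ (counted by index) for which $\Gamma^{(n)}(q)$ is transcendental. The notation $f(N)\asymp g(N)$ as $N\to\infty$ means that there exist constants $0<c\leq C$ such that $c\,g(N)\leq f(N)\leq C\,g(N)$ for all sufficiently large $N$. *)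

(* Defs.v *)
From mathcomp Require Import all_boot all_order all_algebra.
From mathcomp Require Import all_classical all_reals all_analysis.

Set Implicit Arguments.
Unset Strict Implicit.
Unset Printing Implicit Defensive.

Import Order.TTheory GRing.Theory Num.Theory.
Import numFieldNormedType.Exports.
Local Open Scope classical_set_scope.
Local Open Scope ring_scope.

(* Euler's integral; it converges exactly when [0 < x]. *)
Definition Gamma_integral (R : realType) (x : R) : R :=
  \int[@lebesgue_measure R]_(t in `]0, +oo[) (t `^ (x - 1) * expR (- t)).

(* The restriction to the real line of the meromorphic continuation of Euler's
   integral: for real [x] outside {0, -1, -2, ...} and any [k] with
   [0 < x + k], Gamma(x) = Gamma(x + k) / (x (x + 1) ... (x + k - 1)).
   We use the least such [k]. The values at the poles are irrelevant. Since the
   complex Gamma function is holomorphic near each real non-pole, its complex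
   derivatives there are the iterated derivatives of this real function. *)
Definition Gamma (R : realType) (x : R) : R :=
  let k := if x < 0 then `|Num.floor x|%N else 0%N in
  Gamma_integral (x + k%:R) / \prod_(i < k) (x + i%:R).

Definition transcendental (R : realType) (x : R) : Prop :=
  ~ algebraicOver (ratr : rat -> R) x.

Definition half_integer (R : realType) (q : R) : Prop :=
  exists k : int, q = k%:~R / 2.

Definition nonpositive_integer (R : realType) (q : R) : Prop :=
  exists m : nat, q = - m%:R.

Definition delta (R : realType) (q : R) (N : nat) : R :=
  #|[set n : 'I_N.+1 | (1 <= n)%N &&
      `[< transcendental (derive1n n (@Gamma R) q) >]]%SET|%:R / N%:R.

Definition beta (R : realType) (N : nat) : R :=
  Num.max 0 (Num.sqrt N%:R - 5 / 2) / N%:R.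

Definition asymp (R : realType) (f g : nat -> R) : Prop :=
  exists c C : R, [/\ 0 < c, c <= C &
    \forall N \near \oo, c * g N <= f N /\ f N <= C * g N].

(* Main.v *)
Require Import Defs.
From HB Require Import structures.
From mathcomp Require Import all_boot all_order all_algebra all_fingroup.

Set Implicit Arguments.
Unset Strict Implicit.
Unset Printing Implicit Defensive.

Import Order.TTheory GRing.Theory Num.Theory.
Local Open Scope ring_scope.

(** Fix [q] and let [g_n] be the [n]-th Taylor coefficient of Gamma at [q], so that the
    [n]-th derivative there is [n! g_n]; both are transcendental or neither is. Everything rests
    on the even function [phi t = Gamma (q + t) * Gamma (q - t)], read in two ways.

    On the one hand, Euler's reflection formula and the functional equation make [phi] explicit
    when [q] is a half-integer: up to a quotient of rational polynomials not vanishing at 0 it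
    is [pi / cos (pi t)] or [pi t / sin (pi t)] ([Gamma_product_relation]). The Taylor
    coefficients of the secant and of [t / sin t] are positive at even indices
    ([sec_coef_gt0], [sinc_inv_coef_gt0]), so the coefficient of [t^(2k)] in [phi] is, up to a
    common nonzero factor, a polynomial in [pi] with rational coefficients and of degree exactly
    [2k]. Since [pi] is transcendental, the numbers [phi_0, phi_2, phi_4, ...] are therefore
    linearly independent over the field of algebraic reals ([reflected_independent]).

    On the other hand, [phi_(2k)] is the sum of the [(-1)^j g_j g_(2k-j)], a quadratic form in
    [g_0, ..., g_(2k)]. If only [s] of the numbers [g_1, ..., g_N] are transcendental, then all
    of [g_0, ..., g_N] are algebraic multiples of the [s + 2] numbers 1, [g_0] and those [s] ones,
    and the [N/2 + 1] numbers [phi_(2k)] with [2k <= N] lie in the span of the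
    [(s + 2) (s + 3) / 2] products of two of these. Independence forces
    [N/2 + 1 <= (s + 2) (s + 3) / 2] ([transcendental_count]), and solving this quadratic
    inequality for [s] gives the bound ([ceil_bound]).

    Two classical inputs are proved on the way. The transcendence of [pi] follows Lindemann and
    Hermite: if [i pi] were algebraic, the product of the [1 + exp c] over its conjugates [c]
    would vanish, and expanding it over subsets gives a vanishing sum of exponentials of
    algebraic numbers whose power sums are controlled by symmetric functions; this contradicts a
    divisibility against an estimate ([cexp_sum_neq0]). For the reflection formula, Tonelli's
    theorem turns [Gamma x * Gamma (1 - x)] into the integral of [u^(x-1) / (1 + u)]; this
    integral and [pi / sin (pi x)] satisfy the same trisection identity ([eBeta_triple],
    [csc_triple]), and Herglotz' maximum argument shows that they agree
    ([Gamma_integral_reflection]). *)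

(** * Subset sums of the roots of a monic integer polynomial *)

Module SubsetSums.
From mathcomp Require Import mpoly.

Section SubsetSums.
Variables (K : idomainType) (n : nat) (cs : n.-tuple K).
Hypothesis int_roots :
  exists P : {poly int}, map_poly intr P = \prod_(c <- cs) ('X - c%:P).

Let ev : {rmorphism {mpoly int[n]} -> K} := mmap intr (tnth cs).

Let evX i : ev 'X_i = tnth cs i.
Proof. by rewrite [LHS]mmapX mmap1U. Qed.

(** By the fundamental theorem on symmetric polynomials it is enough to treat the elementary
    ones, whose values at the roots are, up to sign, coefficients of the polynomial. *)
Lemma symmetric_at_roots_int (p : {mpoly int[n]}) :
  p \is symmetric -> exists z : int, ev p = z%:~R.
Proof.
move=> /sym_fundamental[t [<- _]].
have ev_esym (k : 'I_n) : exists z : int,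
    ev (tnth [tuple mesym n int i.+1 | i < n] k) = z%:~R.
  have [P PE] := int_roots.
  rewrite tnth_mktuple; have := mroots_coeff cs (lift ord0 k).
  rewrite -PE coef_map /= => PkE.
  exists ((-1) ^+ k.+1 * P`_(n - k.+1)).
  rewrite intrM PkE rmorphXn /= rmorphN1 mulrA -exprMn mulrNN mulr1 expr1n mul1r.
  rewrite /mesym [LHS]rmorph_sum [RHS](rmorph_sum (meval (tnth cs))) /=.
  apply: eq_bigr => h _.
  rewrite [LHS](rmorph_prod ev) [RHS](rmorph_prod (meval (tnth cs))) /=.
  by apply: eq_bigr => j _; rewrite mmapX mmap1U mevalXU.
rewrite comp_mpolyEX (rmorph_sum ev).
have [z zE] : exists z : 'I_n -> int, forall k : 'I_n,
    ev (tnth [tuple mesym n int i.+1 | i < n] k) = (z k)%:~R.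
  exact: (fin_all_exists ev_esym).
exists (\sum_(m <- msupp t) t@_m * \prod_i z i ^+ m i).
rewrite rmorph_sum; apply: eq_bigr => m _.
rewrite [LHS]mmapZ /= rmorphM comp_mpolyX /= [X in _ * X](rmorph_prod ev) rmorph_prod.
congr (_ * _); apply: eq_bigr => i _.
by rewrite [LHS](rmorphXn ev) rmorphXn /= -zE.
Qed.

Let Xsum (S : {set 'I_n}) : {mpoly int[n]} := \sum_(i in S) 'X_i.

Let ev_Xsum S : ev (Xsum S) = \sum_(i in S) tnth cs i.
Proof.
by rewrite /Xsum rmorph_sum; apply: eq_bigr => i _; exact: evX.
Qed.

Let msym_Xsum (s : 'S_n) S : msym s (Xsum S) = Xsum (s @: S).
Proof.
rewrite /Xsum raddf_sum /= big_imset /=; last by move=> i j _ _; apply: perm_inj.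
by apply: eq_bigr => i _; rewrite /msym mmapX mmap1U.
Qed.

Let imset_bij (s : 'S_n) : bijective (fun S : {set 'I_n} => s @: S).
Proof.
apply: injF_bij; apply: imset_inj; exact: perm_inj.
Qed.

(** The coefficients of the product over all subsets are symmetric, because a permutation of
    the roots permutes the subsets. *)
Lemma prod_subset_sums_int : exists U : {poly int},
  map_poly intr U = \prod_(S : {set 'I_n}) ('X - (\sum_(i in S) tnth cs i)%:P).
Proof.
pose V : {poly {mpoly int[n]}} := \prod_(S : {set 'I_n}) ('X - (Xsum S)%:P).
have VE : map_poly ev V = \prod_(S : {set 'I_n}) ('X - (\sum_(i in S) tnth cs i)%:P).
  rewrite rmorph_prod /=; apply: eq_bigr => S _.
  by rewrite raddfB /= map_polyX map_polyC /= ev_Xsum.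
have symV k : V`_k \is symmetric.
  apply/issymP => s.
  rewrite -(coef_map_id0 (f := msym s)) ?msym0 //.
  suff -> : map_poly (msym s) V = V by [].
  have VS : V = \prod_(S : {set 'I_n}) ('X - (Xsum (s @: S))%:P).
    by rewrite /V [LHS](reindex _ (onW_bij _ (imset_bij s))).
  rewrite [RHS]VS [LHS](rmorph_prod (map_poly (msym s))).
  apply: eq_bigr => S _.
  rewrite (rmorphB (map_poly (msym s))) /=.
  by rewrite map_polyX (map_polyC (msym s)) /= msym_Xsum.
have [z zE] : exists z : 'I_(size V) -> int, forall k : 'I_(size V),
    ev V`_k = (z k)%:~R.
  exact: (fin_all_exists (fun k => symmetric_at_roots_int (symV _))).
exists (\poly_(k < size V) oapp z 0 (insub k)).
rewrite -VE; apply/polyP => k; rewrite !coef_map coef_poly /=.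
case: ltnP => [lt_k|le_k].
  by rewrite insubT /= -zE.
by rewrite (nth_default _ le_k) rmorph0 [RHS](rmorph0 ev).
Qed.

Lemma sum_subset_sums_int (h : {poly int}) : exists z : int,
  \sum_(S : {set 'I_n}) (map_poly intr h).[\sum_(i in S) tnth cs i] = z%:~R.
Proof.
pose p : {mpoly int[n]} := \sum_(S : {set 'I_n}) (map_poly intr h).[Xsum S].
have evh q : ev (map_poly intr h).[q] = (map_poly intr h).[ev q].
  rewrite -horner_map -map_poly_comp /=; congr (_.[_]).
  by apply: eq_map_poly => z /=; rewrite rmorph_int.
have [|z zE] := @symmetric_at_roots_int p.
  apply/issymP => s; rewrite /p raddf_sum /=.
  rewrite [RHS](reindex _ (onW_bij _ (imset_bij s))) /=; apply: eq_bigr => S _.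
  rewrite -horner_map -map_poly_comp /= msym_Xsum; congr (_.[_]).
  by apply: eq_map_poly => z /=; rewrite rmorph_int.
exists z; rewrite -zE /p rmorph_sum; apply: eq_bigr => S _.
by rewrite evh ev_Xsum.
Qed.

End SubsetSums.
End SubsetSums.

From mathcomp Require Import complex ring lra.
From mathcomp Require Import all_classical all_reals all_analysis.
From mathcomp Require Import measurable_realfun.
Import numFieldNormedType.Exports.
Local Open Scope classical_set_scope.
Local Open Scope ring_scope.

(** * Derivatives at a point *)

Section PointwiseDerivatives.
Variable R : realType.
Implicit Types (f g : R -> R) (x a b c : R).

Lemma derC x c : is_derive x 1 (fun _ : R => c) 0.
Proof. exact: is_derive_cst. Qed.

Lemma derI x : is_derive x 1 (fun y : R => y) 1.
Proof. exact: is_derive_id. Qed.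

Lemma derD f g x a b : is_derive x 1 f a -> is_derive x 1 g b ->
  is_derive x 1 (fun y => f y + g y) (a + b).
Proof. by move=> *; exact: is_deriveD. Qed.

Lemma derN f x a : is_derive x 1 f a -> is_derive x 1 (fun y => - f y) (- a).
Proof. by move=> *; exact: is_deriveN. Qed.

Lemma derM f g x a b : is_derive x 1 f a -> is_derive x 1 g b ->
  is_derive x 1 (fun y => f y * g y) (a * g x + f x * b).
Proof.
move=> fa gb; have : is_derive x 1 (f * g) (f x *: b + g x *: a).
  exact: is_deriveM.
by move=> H; apply: (is_derive_eq H); rewrite /GRing.scale /= addrC [a * _]mulrC.
Qed.

Lemma derX f n x a : is_derive x 1 f a ->
  is_derive x 1 (fun y => f y ^+ n) (n%:R * f x ^+ n.-1 * a).
Proof.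
elim: n => [|n IHn] fa.
  by rewrite !mul0r; apply: derC.
under eq_fun do rewrite exprS.
apply: (is_derive_eq (derM fa (IHn fa))).
case: n {IHn} => [|n] /=; first by rewrite !expr0; ring.
by rewrite !exprS -[n.+2%:R]natr1; ring.
Qed.

Lemma derV f x a : f x != 0 -> is_derive x 1 f a ->
  is_derive x 1 (fun y => (f y)^-1) (- (f x) ^- 2 * a).
Proof. by move=> *; exact: is_deriveV. Qed.

Lemma der_comp f g x a b : is_derive x 1 f a -> is_derive (f x) 1 g b ->
  is_derive x 1 (fun y => g (f y)) (b * a).
Proof.
move=> fa gb; exact: (@is_derive1_comp _ g f x).
Qed.

Lemma derexp f x a : is_derive x 1 f a ->
  is_derive x 1 (fun y => expR (f y)) (expR (f x) * a).
Proof. by move=> fa; apply: (der_comp fa). Qed.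

Lemma dercos f x a : is_derive x 1 f a ->
  is_derive x 1 (fun y => cos (f y)) (- sin (f x) * a).
Proof. by move=> fa; apply: (der_comp fa). Qed.

Lemma dersin f x a : is_derive x 1 f a ->
  is_derive x 1 (fun y => sin (f y)) (cos (f x) * a).
Proof. by move=> fa; apply: (der_comp fa). Qed.

Lemma der_sum (h : nat -> R -> R) (dh : nat -> R) n x :
  (forall k, is_derive x 1 (h k) (dh k)) ->
  is_derive x 1 (fun y => \sum_(k < n) h k y) (\sum_(k < n) dh k).
Proof.
move=> hdh; have := @is_derive_sum R R R n (fun k => h k) x 1 (fun k => dh k).
move=> /(_ (fun k => hdh k)); congr (is_derive _ _ _ _).
by apply/funext => v; rewrite fct_sumE.
Qed.

End PointwiseDerivatives.

(** Differentiates an explicit formula in its variable, leaving as last goal that the value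
    found is the expected one. The hypotheses on unknown subterms are taken from the context. *)
Ltac pderive := notypeclasses refine (is_derive_eq _ _); [repeat first
  [ eassumption | notypeclasses refine (derC _ _) | notypeclasses refine (derI _)
  | notypeclasses refine (derD _ _) | notypeclasses refine (derN _)
  | notypeclasses refine (derM _ _) | notypeclasses refine (derX _ _)
  | notypeclasses refine (derexp _) | notypeclasses refine (dercos _)
  | notypeclasses refine (dersin _) ] | cbv beta].

(** * The Taylor remainder of the complex exponential *)

(** An integrated form of a bound on the derivative, obtained from monotonicity of
    [K / (n + 1) * v^(n+1) - f v]; iterated, it yields Taylor remainders. *)
Lemma normr_le_of_derive (R : realType) (f df : R -> R) (K : R) (n : nat) :
  f 0 = 0 -> (forall u : R, is_derive u 1 f (df u)) ->
  (forall u : R, 0 <= u <= 1 -> `|df u| <= K * u ^+ n) ->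
  forall u : R, 0 <= u <= 1 -> `|f u| <= K / n.+1%:R * u ^+ n.+1.
Proof.
move=> f0 fdf dfK u u01.
have n0 : n.+1%:R != 0 :> R by rewrite pnatr_eq0.
(* one-sided version, to be used for f and for -f *)
have one_sided (g dg : R -> R) : g 0 = 0 -> (forall v : R, is_derive v 1 g (dg v)) ->
    (forall v : R, 0 <= v <= 1 -> `|dg v| <= K * v ^+ n) ->
    g u <= K / n.+1%:R * u ^+ n.+1.
  move=> g0 gdg dgK.
  pose h v := K / n.+1%:R * v ^+ n.+1 - g v.
  have hdh (v : R) : is_derive v 1 h (K * v ^+ n - dg v).
    have := gdg v => gdgv; rewrite /h; pderive.
    by rewrite mul0r add0r mulr1 mulrA divfK.
  suff : h 0 <= h u.
    by rewrite /h g0 expr0n /= mulr0 subrr subr_ge0.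
  move/andP : u01 => [u0 u1].
  apply: (@ger0_derive1_ndecr _ h 0 1) => //.
  - move=> v v01; rewrite derive1E derive_val subr_ge0.
    apply: le_trans (ler_norm _) (dgK _ _).
    by move: v01; rewrite in_itv /= => /andP[/ltW-> /ltW->].
  - apply: derivable_within_continuous => v _; exact: ex_derive.
rewrite ler_norml; apply/andP; split; last exact: (one_sided _ df).
rewrite lerNl; apply: (one_sided (fun v => - f v) (fun v => - df v)).
- by rewrite f0 oppr0.
- by move=> v v01; rewrite normrN; apply: dfK.
Qed.

Section ComplexExponential.
Variable R : realType.
Local Notation C := R[i].
Implicit Types (z w : C) (u : R).

Definition cexp z : C :=
  Complex (expR (complex.Re z) * cos (complex.Im z)) (expR (complex.Re z) * sin (complex.Im z)).

Lemma cexpD z w : cexp (z + w) = cexp z * cexp w.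
Proof.
case: z w => [a b] [c d]; rewrite /cexp /=.
by apply/eqP; rewrite eq_complex /= expRD cosD sinD; apply/andP; split;
  apply/eqP; ring.
Qed.

Lemma cexp0 : cexp 0 = 1.
Proof. by rewrite /cexp /= expR0 cos0 sin0 mulr1 mulr0. Qed.

Lemma cexp_sum (I : Type) (r : seq I) (P : pred I) (F : I -> C) :
  cexp (\sum_(i <- r | P i) F i) = \prod_(i <- r | P i) cexp (F i).
Proof. exact: (big_morph cexp cexpD cexp0). Qed.

Lemma cexp_ipi : cexp (Complex 0 pi) = -1.
Proof.
rewrite /cexp /= expR0 cospi sinpi mulr0 !mul1r.
by apply/eqP; rewrite eq_complex /= oppr0 !eqxx.
Qed.

(** The taxicab norm: it is submultiplicative, which is all that the estimates
    below use, and it reads off directly from bounds on the two real parts. *)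
Definition norm1c z : R := `|complex.Re z| + `|complex.Im z|.

Lemma norm1c_ge0 z : 0 <= norm1c z.
Proof. by rewrite addr_ge0. Qed.

Lemma norm1cD z w : norm1c (z + w) <= norm1c z + norm1c w.
Proof.
case: z w => [a b] [c d]; rewrite /norm1c /= addrACA.
by rewrite lerD // ler_normD.
Qed.

Lemma norm1c_sum (I : Type) (r : seq I) (P : pred I) (F : I -> C) :
  norm1c (\sum_(i <- r | P i) F i) <= \sum_(i <- r | P i) norm1c (F i).
Proof.
elim/big_ind2 : _ => [|x1 x2 y1 y2 h1 h2|//].
  by rewrite /norm1c /= !normr0 addr0.
by apply: le_trans (norm1cD _ _) _; rewrite lerD.
Qed.

Lemma norm1cM z w : norm1c (z * w) <= norm1c z * norm1c w.
Proof.
case: z w => [a b] [c d]; rewrite /norm1c /=.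
have -> : (`|a| + `|b|) * (`|c| + `|d|) =
    (`|a * c| + `|b * d|) + (`|a * d| + `|b * c|).
  by rewrite !normrM; ring.
by rewrite lerD // ?ler_normD // ler_normB.
Qed.

Lemma norm1c_int (k : int) : norm1c (k%:~R : C) = `|k%:~R : R|.
Proof.
have -> : (k%:~R : C) = (k%:~R : R)%:C%C.
  exact: (esym (rmorph_int (real_complex R) k)).
by rewrite /norm1c /= normr0 addr0.
Qed.

Lemma ReM z w : complex.Re (z * w) =
  complex.Re z * complex.Re w - complex.Im z * complex.Im w.
Proof. by case: z w => [a b] [c d]. Qed.

Lemma ImM z w : complex.Im (z * w) =
  complex.Im z * complex.Re w + complex.Re z * complex.Im w.
Proof. by case: z w => [a b] [c d] /=; rewrite addrC. Qed.

(** [P n u] and [Q n u] are the real and imaginary parts of the [n]-th Taylor remainder of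
    [cexp (u z)]. As [u] varies they satisfy a linear differential system in which [P n.+1] and
    [Q n.+1] have derivatives in terms of [P n] and [Q n], so the remainders are bounded by
    induction on [n]. *)
Section TaylorRemainder.
Variable z : C.
Let a := complex.Re z.
Let b := complex.Im z.
Let P n u := expR (u * a) * cos (u * b) - \sum_(k < n) u ^+ k / k`!%:R * complex.Re (z ^+ k).
Let Q n u := expR (u * a) * sin (u * b) - \sum_(k < n) u ^+ k / k`!%:R * complex.Im (z ^+ k).

Let dsum (c : nat -> R) n u :
  is_derive u 1 (fun u : R => \sum_(k < n.+1) u ^+ k / k`!%:R * c k)
    (\sum_(k < n) u ^+ k / k`!%:R * c k.+1).
Proof.
have dk k : is_derive u 1 (fun u : R => u ^+ k / k`!%:R * c k)
    (k%:R * u ^+ k.-1 / k`!%:R * c k).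
  by pderive; rewrite !mulr0 !addr0 mulr1.
apply: (is_derive_eq (der_sum _ dk)).
rewrite big_ord_recl /= !mul0r add0r; apply: eq_bigr => k _.
rewrite /bump /= add1n factS natrM invfM; congr (_ * _).
by rewrite mulrACA divff ?pnatr_eq0 // mul1r.
Qed.

Let dP n u : is_derive u 1 (P n.+1) (a * P n u - b * Q n u).
Proof.
have := dsum (fun k => complex.Re (z ^+ k)) n u => ?.
rewrite /P; pderive.
rewrite /Q.
under eq_bigr do rewrite exprS.
have -> : \sum_(i < n) u ^+ i / i`!%:R * complex.Re (z * z ^+ i) =
   a * (\sum_(i < n) u ^+ i / i`!%:R * complex.Re (z ^+ i)) -
   b * (\sum_(i < n) u ^+ i / i`!%:R * complex.Im (z ^+ i)).
  rewrite !mulr_sumr -sumrB; apply: eq_bigr => i _.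
  by rewrite ReM -/a -/b; ring.
ring.
Qed.

Let dQ n u : is_derive u 1 (Q n.+1) (a * Q n u + b * P n u).
Proof.
have := dsum (fun k => complex.Im (z ^+ k)) n u => ?.
rewrite /Q; pderive.
rewrite /P.
under eq_bigr do rewrite exprS.
have -> : \sum_(i < n) u ^+ i / i`!%:R * complex.Im (z * z ^+ i) =
   a * (\sum_(i < n) u ^+ i / i`!%:R * complex.Im (z ^+ i)) +
   b * (\sum_(i < n) u ^+ i / i`!%:R * complex.Re (z ^+ i)).
  rewrite !mulr_sumr -big_split /=; apply: eq_bigr => i _.
  by rewrite ImM -/a -/b; ring.
ring.
Qed.

Let sum0 (c : nat -> R) n : \sum_(k < n.+1) (0 : R) ^+ k / k`!%:R * c k = c 0.
Proof.
rewrite big_ord_recl big1 ?addr0 ?expr0 ?fact0 ?divr1 ?mul1r // => k _.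
by rewrite expr0n /= !mul0r.
Qed.

Let bound n u : 0 <= u <= 1 ->
  `|P n u| <= expR `|a| * (norm1c z) ^+ n / n`!%:R * u ^+ n /\
  `|Q n u| <= expR `|a| * (norm1c z) ^+ n / n`!%:R * u ^+ n.
Proof.
elim: n u => [|n IHn] u u01.
  rewrite /P /Q !big_ord0 !subr0 !normrM !expr0 fact0 divr1 !mulr1.
  have le_exp : `|expR (u * a)| <= expR `|a|.
    rewrite ger0_norm ?expR_ge0 // ler_expR.
    move/andP : u01 => [u0 u1].
    apply: le_trans (ler_norm _) _.
    by rewrite normrM (ger0_norm u0) ler_piMl.
  by split; rewrite -[leRHS]mulr1; apply: ler_pM => //;
    rewrite ?cos_max ?sin_max.
have E : expR `|a| * (norm1c z) ^+ n.+1 / n.+1`!%:R =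
    (norm1c z * (expR `|a| * (norm1c z) ^+ n / n`!%:R)) / n.+1%:R.
  rewrite factS natrM invfM exprS; ring.
have comb (x y c d M : R) : `|c| <= M -> `|d| <= M -> `|x| + `|y| <= norm1c z ->
    `|x * c| + `|y * d| <= norm1c z * M.
  move=> cM dM xy; rewrite !normrM.
  have M0 : 0 <= M by apply: le_trans cM.
  apply: (@le_trans _ _ (`|x| * M + `|y| * M)).
    by rewrite lerD // ler_wpM2l.
  by rewrite -mulrDl ler_wpM2r.
rewrite E; split.
- apply: (normr_le_of_derive (df := fun u => a * P n u - b * Q n u)) => //.
    by rewrite /P (sum0 (fun k => complex.Re (z ^+ k))) !mul0r expR0 cos0 mulr1 expr0 /= subrr.
  move=> v v01; apply: le_trans (ler_normB _ _) _.
  have [hP hQ] := IHn v v01.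
  by rewrite -mulrA; apply: comb.
- apply: (normr_le_of_derive (df := fun u => a * Q n u + b * P n u)) => //.
    by rewrite /Q (sum0 (fun k => complex.Im (z ^+ k))) !mul0r expR0 sin0 mulr0 expr0 /= subrr.
  move=> v v01; apply: le_trans (ler_normD _ _) _.
  have [hP hQ] := IHn v v01.
  by rewrite -mulrA; apply: comb.
Qed.

Lemma cexp_taylor n :
  norm1c (cexp z - \sum_(k < n) z ^+ k / k`!%:R)
    <= expR `|complex.Re z| * (norm1c z) ^+ n / n`!%:R *+ 2.
Proof.
have [|hP hQ] := @bound n 1; first by rewrite ler01 lexx.
rewrite expr1n mulr1 in hP hQ.
have ReE (k : nat) : z ^+ k / k`!%:R = ((k`!%:R : R)^-1)%:C%C * z ^+ k.
  by rewrite mulrC fmorphV rmorph_nat.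
under eq_bigr do rewrite ReE.
have -> : cexp z - \sum_(k < n) ((k`!%:R : R)^-1)%:C%C * z ^+ k =
   Complex (P n 1) (Q n 1).
  have -> : \sum_(k < n) ((k`!%:R : R)^-1)%:C%C * z ^+ k = Complex
      (\sum_(k < n) 1 ^+ k / k`!%:R * complex.Re (z ^+ k))
      (\sum_(k < n) 1 ^+ k / k`!%:R * complex.Im (z ^+ k)).
    elim/big_rec3 : _ => [//|k x y w _ ->].
    rewrite expr1n; case: (z ^+ k) => [s t] /=.
    by apply/eqP; rewrite eq_complex /=; apply/andP; split; apply/eqP; ring.
  by rewrite /P /Q !mul1r /cexp.
by rewrite mulr2n lerD.
Qed.

End TaylorRemainder.
End ComplexExponential.

(** * Hermite's functional *)

Lemma derivn_root_exp (K : comNzRingType) (T h : {poly K}) (x : K) (p j : nat) :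
  root T x -> (j < p)%N -> (T ^+ p * h)^`(j).[x] = 0.
Proof.
move=> /rootP Tx0 lt_jp.
have [h' ->] : exists h', (T ^+ p * h)^`(j) = T ^+ (p - j) * h'.
  elim: j lt_jp => [|j IHj] lt_jp; first by exists h; rewrite subn0.
  have [h' hE] := IHj (ltnW lt_jp).
  exists (T^`() *+ (p - j) * h' + T * h'^`()).
  rewrite derivnS hE derivM deriv_exp -[in T ^+ (p - j) * _](subnSK (ltnW lt_jp)).
  by rewrite subnS exprS /=; ring.
by rewrite hornerM horner_exp Tx0 expr0n subn_eq0 leqNgt lt_jp mul0r.
Qed.

Section Hermite.
Variable R : realType.
Local Notation C := R[i].
Implicit Types (a z : C) (g : {poly C}).

(** Hermite's functional, the polynomial [sum_j f^(j)] for [f = g(a X)]: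
    multiplying its value at 0 by [cexp z] nearly gives its value at [z]. *)
Definition herm a N g z : C := \sum_(j < N) a ^+ j * g^`(j).[a * z].

Lemma herm_sum a N g z :
  herm a N g z = \sum_(i < size g) g`_i * herm a N 'X^i z.
Proof.
rewrite /herm; under [RHS]eq_bigr do rewrite mulr_sumr.
rewrite exchange_big /=; apply: eq_bigr => j _.
rewrite -{1}[g]coefK poly_def raddf_sum horner_sum mulr_sumr.
by apply: eq_bigr => i _; rewrite /= derivnZ hornerZ mulrCA.
Qed.

Lemma hermXn a N n z : (n < N)%N ->
  herm a N 'X^n z = a ^+ n * n`!%:R * \sum_(k < n.+1) z ^+ k / k`!%:R.
Proof.
move=> lt_nN.
rewrite mulr_sumr /herm -(big_mkord xpredT (fun j => a ^+ j * ('X^n)^`(j).[a * z])).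
rewrite (@big_cat_nat _ _ _ n.+1) //= [X in _ + X]big_nat_cond [X in _ + X]big1 ?addr0.
  rewrite big_mkord (reindex_inj rev_ord_inj) /=; apply: eq_bigr => k _.
  have le_kn : (k <= n)%N by rewrite -ltnS.
  rewrite subSS derivnXn hornerMn hornerXn subKn // exprMn -mulrnAl.
  have := ffact_fact (leq_subr k n); rewrite subKn // => <-.
  rewrite natrM.
  have k0 : k`!%:R != 0 :> C by rewrite pnatr_eq0 -lt0n fact_gt0.
  have -> : a ^+ n = a ^+ (n - k) * a ^+ k by rewrite -exprD subnK.
  rewrite -mulr_natl.
  move: (k`!%:R : C) (_%:R : C) (a ^+ _) (a ^+ _) (z ^+ _) k0 => f r u v w f0.
  by field.
move=> j /andP[/andP[lt_nj _] _].
by rewrite derivnXn ffact_small // mulr0n horner0 mulr0.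
Qed.

Lemma norm1c_nat n : norm1c (n%:R : C) = n%:R.
Proof. by have := norm1c_int R n; rewrite ger0_norm ?ler0n. Qed.

(** On monomials [cexp z * herm 0 - herm z] is a factorial times a Taylor remainder of the
    exponential, and the factorial cancels the one in the bound for that remainder. *)
Lemma herm_bound a N g z : (size g <= N)%N ->
  norm1c (cexp z * herm a N g 0 - herm a N g z) <=
  expR `|complex.Re z| * norm1c z *+ 2 *
    \sum_(i < size g) norm1c (g`_i * a ^+ i) * norm1c z ^+ i.
Proof.
move=> sgN; rewrite !herm_sum !mulr_sumr -sumrB.
apply: le_trans (norm1c_sum _ _ _) _; apply: ler_sum => i _.
have lt_iN : (i < N)%N by apply: leq_trans sgN.
rewrite !hermXn //.
have -> : \sum_(k < i.+1) (0 : C) ^+ k / k`!%:R = 1.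
  rewrite big_ord_recl big1 ?addr0 ?expr0 ?fact0 ?divr1 // => k _.
  by rewrite expr0n /= mul0r.
rewrite mulr1.
have -> : cexp z * (g`_i * (a ^+ i * i`!%:R)) -
   g`_i * (a ^+ i * i`!%:R * \sum_(k < i.+1) z ^+ k / k`!%:R) =
   (g`_i * a ^+ i) * i`!%:R * (cexp z - \sum_(k < i.+1) z ^+ k / k`!%:R).
  by ring.
apply: le_trans (norm1cM _ _) _.
apply: le_trans (ler_wpM2l (norm1c_ge0 _) (cexp_taylor _ _)) _.
set E := expR _; set m := norm1c z; set A := norm1c (g`_i * a ^+ i).
have E0 : 0 <= E by apply: expR_ge0.
have m0 : 0 <= m by apply: norm1c_ge0.
apply: (@le_trans _ _ (A * i`!%:R * (E * m ^+ i.+1 / i.+1`!%:R *+ 2))).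
  apply: ler_wpM2r.
    by rewrite mulrn_wge0 // divr_ge0 ?mulr_ge0 ?exprn_ge0.
  by apply: le_trans (norm1cM _ _) _; rewrite norm1c_nat.
have -> : A * i`!%:R * (E * m ^+ i.+1 / i.+1`!%:R *+ 2) =
   (E * m *+ 2 * (A * m ^+ i)) / i.+1%:R.
  rewrite factS natrM exprS.
  have f0 : i`!%:R != 0 :> R by rewrite pnatr_eq0 -lt0n fact_gt0.
  have i0 : i.+1%:R != 0 :> R by rewrite pnatr_eq0.
  move: (i`!%:R : R) (i.+1%:R : R) (m ^+ i) f0 i0 => f s mi f0 i0.
  by field; rewrite i0 f0.
rewrite ler_piMr ?invf_le1 ?ler1n ?ltr0n //.
by rewrite mulr_ge0 ?mulrn_wge0 ?mulr_ge0 ?exprn_ge0 // norm1c_ge0.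
Qed.

End Hermite.

Definition abs_horner (R : realType) (g : {poly int}) (x : R) : R :=
  \sum_(i < size g) `|g`_i|%:~R * x ^+ i.

Section AbsHorner.
Variables (R : realType) (x : R).
Hypothesis x_ge0 : 0 <= x.

Let dom (g : {poly int}) (G : {poly R}) := forall i, `|g`_i|%:~R <= G`_i.

Let domM g1 G1 g2 G2 : dom g1 G1 -> dom g2 G2 -> dom (g1 * g2) (G1 * G2).
Proof.
move=> d1 d2 i; rewrite !coefM intr_norm rmorph_sum.
apply: le_trans (ler_norm_sum _ _ _) _; apply: ler_sum => j _.
rewrite rmorphM normrM -!intr_norm.
by apply: ler_pM => //; rewrite ler0z normr_ge0.
Qed.

Let dom_horner g G : dom g G -> abs_horner g x <= G.[x].
Proof.
move=> dG; have G0 i : 0 <= G`_i by apply: le_trans (dG i); rewrite ler0z.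
pose n := maxn (size g) (size G).
have -> : abs_horner g x = \sum_(i < n) `|g`_i|%:~R * x ^+ i.
  rewrite /abs_horner (big_ord_widen n (fun i => `|g`_i|%:~R * x ^+ i)) ?leq_maxl //.
  rewrite big_mkcond; apply: eq_bigr => i _; case: ltnP => // le_gi.
  by rewrite nth_default // normr0 mul0r.
rewrite (@horner_coef_wide _ n) ?leq_maxr //; apply: ler_sum => i _.
by rewrite ler_wpM2r ?exprn_ge0.
Qed.

Lemma abs_horner_ge0 g : 0 <= abs_horner g x.
Proof. by apply: sumr_ge0 => i _; rewrite mulr_ge0 ?exprn_ge0 // ler0z. Qed.

(** The absolute values of the coefficients of a product are dominated by the coefficients of
    the product of the polynomials of absolute values. *)
Lemma abs_hornerXnM (T : {poly int}) q p :
  abs_horner ('X^q * T ^+ p) x <= x ^+ q * abs_horner T x ^+ p.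
Proof.
pose TT : {poly R} := \poly_(i < size T) `|T`_i|%:~R.
have dT : dom T TT.
  move=> i; rewrite coef_poly; case: ltnP => // le_i.
  by rewrite nth_default.
have -> : x ^+ q * abs_horner T x ^+ p = ('X^q * TT ^+ p).[x].
  rewrite hornerM hornerXn horner_exp horner_poly; congr (_ * _ ^+ _).
apply: dom_horner; apply: domM.
  by move=> i; rewrite !coefXn; case: (i == q).
elim: p => [|p IHp]; last by rewrite !exprS; apply: domM.
by move=> i; rewrite !expr0 !coef1; case: (i == 0%N).
Qed.

End AbsHorner.

(** * The transcendence of pi *)

Section HermiteSum.
Variables (R : realType) (I : finType).
Local Notation C := R[i].
Variables (gam : I -> C) (U : {poly int}).
Hypothesis UE : map_poly intr U = \prod_(S : I) ('X - (gam S)%:P).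
Hypothesis power_sums : forall h : {poly int},
  exists z : int, \sum_(S : I) (map_poly intr h).[gam S] = z%:~R.

Let k := #|[pred S | gam S == 0]|.

Let T := drop_poly k U.

Let mapU : map_poly intr U = 'X^k * \prod_(S | gam S != 0) ('X - (gam S)%:P) :> {poly C}.
Proof.
rewrite UE (bigID (fun S => gam S == 0)) /=; congr (_ * _).
rewrite (eq_bigr (fun _ => 'X)) ?prodr_const // => S /eqP->.
by rewrite subr0.
Qed.

Let U_XkT : U = 'X^k * T.
Proof.
rewrite -{1}(poly_take_drop k U) mulrC -[RHS]add0r; congr (_ + _).
apply/polyP => i; rewrite coef_take_poly coef0; case: ltnP => // lt_ik.
have := congr1 (fun p : {poly C} => p`_i) mapU.
by rewrite coef_map coefXnM lt_ik => /eqP; rewrite intr_eq0 => /eqP.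
Qed.

Let mapT : map_poly intr T = \prod_(S | gam S != 0) ('X - (gam S)%:P) :> {poly C}.
Proof.
have Xk0 : 'X^k != 0 :> {poly C} by rewrite -size_poly_eq0 size_polyXn.
by apply: (mulfI Xk0); rewrite -mapU U_XkT rmorphM /= map_polyXn.
Qed.

Let rootT S : gam S != 0 -> root (map_poly intr T) (gam S).
Proof.
move=> gS0; rewrite mapT /root horner_prod (bigD1 S) //=.
by rewrite hornerXsubC subrr mul0r.
Qed.

Let T0_neq0 : T`_0 != 0.
Proof.
rewrite -(intr_eq0 C) -(coef_map intr) /= mapT -horner_coef0 horner_prod.
apply/prodf_neq0 => S gS0.
by rewrite hornerXsubC sub0r oppr_eq0.
Qed.

(** The value at the [gam S] of Hermite's functional for [X^q T^(q+1)], where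
    [T] has the nonzero [gam S] as its roots: the derivatives of order [< q]
    vanish everywhere, the one of order [q] vanishes except where
    [gam S = 0], and the others are multiples of [(q+1)!]. *)
Lemma herm_sum_int (a : int) (q : nat) : a != 0 ->
  let g := 'X^q * T ^+ q.+1 in
  exists z : int, \sum_(S : I)
    herm (a%:~R : C) (size g + q.+1) (map_poly intr g) (gam S / a%:~R) =
  (q`!%:Z * (k%:Z * a ^+ q * T`_0 ^+ q.+1 + q.+1%:Z * z))%:~R.
Proof.
move=> a0 g.
have aC0 : a%:~R != 0 :> C by rewrite intr_eq0.
pose s j : C := \sum_(S : I) (map_poly intr g)^`(j).[gam S].
have -> : \sum_(S : I) herm (a%:~R : C) (size g + q.+1) (map_poly intr g)
    (gam S / a%:~R) = \sum_(j < size g + q.+1) a%:~R ^+ j * s j.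
  rewrite /herm exchange_big /=; apply: eq_bigr => j _.
  by rewrite mulr_sumr; apply: eq_bigr => S _; rewrite mulrCA divff ?mulr1.
have gE : map_poly intr g = (map_poly intr T) ^+ q.+1 * 'X^q :> {poly C}.
  by rewrite mulrC /g rmorphM /= map_polyXn rmorphXn.
have vanish j S : gam S != 0 -> (j <= q)%N ->
    (map_poly intr g)^`(j).[gam S] = 0.
  by move=> gS0 le_jq; rewrite gE; apply: derivn_root_exp; rewrite ?rootT.
have s_lt j : (j < q)%N -> s j = 0.
  move=> lt_jq; apply: big1 => S _.
  have [->|/vanish->//] := eqVneq (gam S) 0; last exact: ltnW.
  rewrite horner_coef0 coef_derivn addn0 coef_map /= /g coefXnM lt_jq.
  by rewrite mul0rn.
have s_q : s q = (q`!%:Z * (k%:Z * T`_0 ^+ q.+1))%:~R.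
  rewrite /s (bigID (fun S => gam S == 0)) /= [X in _ + X]big1 ?addr0; last first.
    by move=> S /vanish ->.
  rewrite (eq_bigr (fun _ => ((q`!%:Z * T`_0 ^+ q.+1)%:~R : C))); last first.
    move=> S /eqP->; rewrite horner_coef0 coef_derivn addn0 coef_map /= /g.
    rewrite coefXnM ltnn subnn -!horner_coef0 horner_exp ffactnn.
    by rewrite intrM mulrC -mulr_natr.
  rewrite sumr_const -/k -mulr_natr -[k%:R]/(k%:Z%:~R) -intrM; congr (_%:~R).
  by rewrite mulrC mulrCA.
have s_gt j : exists z : int, s (q.+1 + j)%N = (q`!%:Z * (q.+1%:Z * z))%:~R.
  have [z zE] := power_sums g^`N(q.+1 + j).
  exists (((q.+1 + j)`! %/ q.+1`!)%N%:Z * z).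
  have fE : q`!%:Z * (q.+1%:Z * (((q.+1 + j)`! %/ q.+1`!)%N%:Z * z)) =
      (q.+1 + j)`!%:Z * z.
    rewrite !mulrA; congr (_ * _); rewrite -!PoszM; congr Posz.
    rewrite [(q`! * _)%N]mulnC -factS mulnC divnK //.
    by rewrite addnC -(ffact_fact (leq_addr q.+1 j)) addKn dvdn_mull.
  rewrite fE intrM -zE mulr_sumr; apply: eq_bigr => S _.
  rewrite nderivn_def hornerMn -mulr_natl; congr (_ * _.[_]).
  apply/polyP => i; rewrite coef_map !coef_nderivn coef_map /=.
  by rewrite rmorphMn.
have [z zE] : exists z : nat -> int, forall j,
    s (q.+1 + j)%N = (q`!%:Z * (q.+1%:Z * z j))%:~R.
  by exists (fun j => projT1 (cid (s_gt j))) => j; case: cid.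
exists (\sum_(j < size g) a ^+ (q.+1 + j) * z j).
rewrite addnC big_split_ord /= big_ord_recr /= big1 ?add0r; last first.
  by move=> j _; rewrite s_lt ?mulr0.
rewrite s_q mulrDr intrD; congr (_ + _).
  by rewrite -rmorphXn -rmorphM /=; congr (_%:~R); ring.
rewrite mulr_sumr mulr_sumr rmorph_sum; apply: eq_bigr => j _.
by rewrite zE -rmorphXn -rmorphM /=; congr (_%:~R); ring.
Qed.

Hypothesis zero_gam : exists S, gam S = 0.

(** If the sum vanished, the sum over [S] of the values of Hermite's functional would be both
    small and an integer multiple of [q!]: it is at most a constant times a [q]-th power by
    [herm_bound]. So for large [q] that integer is 0, and then, for [q + 1] a large prime,
    [herm_sum_int] makes [q + 1] divide a fixed nonzero integer. The number [k] of indices with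
    [gam S = 0] has to be positive for that integer to be nonzero. *)
Lemma cexp_sum_neq0 (a : int) : a != 0 ->
  \sum_(S : I) cexp (gam S / a%:~R) != 0 :> C.
Proof.
move=> a0; apply/eqP => sum0.
have k0 : (0 < k)%N.
  by case: zero_gam => S gS0; apply/card_gt0P; exists S; rewrite inE gS0.
pose m S := norm1c (gam S / (a%:~R : C)).
pose y S : R := `|a|%:~R * m S.
pose E S := expR `|complex.Re (gam S / (a%:~R : C))| * m S *+ 2.
pose B S := y S * abs_horner T (y S).
have m0 S : 0 <= m S by apply: norm1c_ge0.
have y0 S : 0 <= y S by rewrite mulr_ge0 // ler0z.
have E0 S : 0 <= E S by rewrite mulrn_wge0 // mulr_ge0 // expR_ge0.
have B0 S : 0 <= B S by rewrite mulr_ge0 // abs_horner_ge0.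
pose A := \sum_S E S * abs_horner T (y S).
pose D := \sum_S B S.
have upper q : let g := 'X^q * T ^+ q.+1 in
    norm1c (\sum_(S : I) herm (a%:~R : C) (size g + q.+1) (map_poly intr g)
       (gam S / a%:~R)) <= A * D ^+ q.
  move=> g; set N := (_ + _)%N; set G := map_poly intr g.
  have sG : size G = size g by rewrite size_map_inj_poly //; apply: intr_inj.
  have -> : \sum_(S : I) herm (a%:~R : C) N G (gam S / a%:~R) =
     - \sum_(S : I) (cexp (gam S / a%:~R) * herm a%:~R N G 0 -
                     herm a%:~R N G (gam S / a%:~R)).
    by rewrite sumrB -mulr_suml sum0 mul0r sub0r opprK.
  have norm1cN w : norm1c (- w) = norm1c w :> R.
    by case: w => [u v]; rewrite /norm1c /= !normrN.
  rewrite norm1cN; apply: le_trans (norm1c_sum _ _ _) _.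
  rewrite /A mulr_suml; apply: ler_sum => S _.
  apply: le_trans (herm_bound _ _ _) _; first by rewrite sG leq_addr.
  rewrite -/(m S) -/(E S) -mulrA ler_wpM2l //.
  have -> : \sum_(i < size G) norm1c (G`_i * a%:~R ^+ i) * m S ^+ i =
      abs_horner g (y S).
    rewrite sG; apply: eq_bigr => i _.
    rewrite coef_map /= -rmorphXn -rmorphM /= norm1c_int -intr_norm normrM normrX.
    by rewrite intrM /y exprMn mulrA rmorphXn.
  apply: le_trans (abs_hornerXnM (y0 S) _ _ _) _.
  rewrite exprS mulrCA ler_wpM2l ?abs_horner_ge0 //.
  have D0 : 0 <= D by apply: sumr_ge0.
  rewrite -exprMn; apply: lerXn2r; rewrite ?nnegrE //; first exact: B0.
  by rewrite /D (bigD1 S) //= lerDl sumr_ge0.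
have A0 : 0 <= A by apply: sumr_ge0 => S _; rewrite mulr_ge0 // abs_horner_ge0.
have : A * (D ^+ n / n`!%:R) @[n --> \oo] --> A * 0.
  by apply: cvgMl_tmp; apply: pi_irrational.exp_fact.
rewrite mulr0 => /cvgrPdist_lt /(_ 1 ltr01) [n0 _ small].
(* a prime larger than the integer that it will have to divide *)
have [p p_gt p_prime] := prime_above (n0 + absz (k%:Z * a * T`_0)%R).
case: p p_gt p_prime => // q q_gt q_prime.
have lt_Nq : `|A * (D ^+ q / q`!%:R)| < 1.
  have := small q; rewrite /= sub0r normrN; apply.
  by rewrite -ltnS (leq_ltn_trans _ q_gt) ?leq_addr.
have [z zE] := herm_sum_int q a0.
have := upper q; rewrite /= zE norm1c_int -intr_norm => ub.
have f0 : 0 < q`!%:R :> R by rewrite ltr0n fact_gt0.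
have lt_fq : A * D ^+ q < q`!%:R.
  move: lt_Nq; rewrite mulrA ger0_norm; last first.
    by rewrite divr_ge0 ?mulr_ge0 ?exprn_ge0 // sumr_ge0.
  by rewrite ltr_pdivrMr ?mul1r.
move: (le_lt_trans ub lt_fq); rewrite -[q`!%:R]/(q`!%:Z%:~R) ltr_int.
rewrite normrM -[ltRHS]mulr1 ger0_norm ?ler0z // ltr_pM2l ?ltz_nat ?fact_gt0 //.
rewrite ltnS leqn0 absz_eq0 => /eqP W0.
have : (q.+1 %| absz (k%:Z * a ^+ q * T`_0 ^+ q.+1)%R)%N.
  rewrite -[q.+1]/(`|q.+1%:Z|%N) -dvdzE; apply/dvdzP; exists (- z).
  by move/eqP: W0; rewrite addr_eq0 => /eqP ->; rewrite mulNr mulrC.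
have div_abs w : (q.+1 %| absz w)%N -> (absz w < q.+1)%N -> w = 0.
  move=> dvd lt; apply/eqP; rewrite -absz_eq0 -leqn0 leqNgt; apply/negP => gt0.
  by have := dvdn_leq gt0 dvd; rewrite leqNgt lt.
have ktal : (q.+1 %| absz (k%:Z * a * T`_0)%R)%N -> False.
  move=> /div_abs/(_ (leq_ltn_trans (leq_addl _ _) q_gt))/eqP.
  by rewrite !mulf_eq0 eqz_nat (negbTE a0) (negbTE T0_neq0) -[k]prednK.
rewrite !abszM !abszX !Euclid_dvdM // !Euclid_dvdX // => dvd.
apply: ktal; rewrite !abszM !Euclid_dvdM //.
by move: dvd => /orP[/orP[->|/andP[->]]|/andP[->]]; rewrite ?orbT.
Qed.

End HermiteSum.

(** Multiplying a polynomial of degree [n + 1] with leading coefficient [a] by [a^n] makes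
    it monic in the variable [a x]. *)
Lemma int_multiple_integral (K : numFieldType) (x : K) :
  algebraicOver (ratr : rat -> K) x ->
  exists (a : int) (Q : {poly int}), [/\ a != 0, Q \is monic &
    root (map_poly intr Q) (a%:~R * x)].
Proof.
move=> [p p0 px0]; have [q [b b0 pE]] := rat_poly_scale p.
have q0 : q != 0.
  by apply: contraNneq p0 => q0; rewrite pE q0 map_poly0 scaler0.
have qx0 : root (map_poly intr q) x.
  move: px0; rewrite pE map_polyZ /= -map_poly_comp rootZ ?fmorph_eq0 ?invr_eq0 ?intr_eq0 //.
  by congr (root _ _); apply: eq_map_poly => z /=; rewrite ratr_int.
have sq : (1 < size q)%N.
  have /root_size_gt1 : map_poly intr q != 0 :> {poly K}.
    by rewrite -size_poly_eq0 size_map_inj_poly ?size_poly_eq0 //; apply: intr_inj.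
  by move=> /(_ _ qx0); rewrite size_map_inj_poly //; apply: intr_inj.
pose n := (size q).-2; have sqE : size q = n.+2 by rewrite /n; case: size sq => [|[]].
pose a := lead_coef q.
pose Q : {poly int} := 'X^(n.+1) + \poly_(i < n.+1) (q`_i * a ^+ (n - i)).
exists a, Q; split; first by rewrite lead_coef_eq0.
  by rewrite monicE /Q lead_coefDl ?lead_coefXn // size_polyXn ltnS size_poly.
rewrite /root rmorphD /= map_polyXn hornerD hornerXn.
have -> : (map_poly intr (\poly_(i < n.+1) (q`_i * a ^+ (n - i)))).[a%:~R * x] =
    a%:~R ^+ n * \sum_(i < n.+1) (q`_i)%:~R * x ^+ i :> K.
  rewrite (@horner_coef_wide _ n.+1); last first.
    by rewrite size_map_inj_poly ?size_poly //; apply: intr_inj.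
  rewrite mulr_sumr; apply: eq_bigr => i _.
  rewrite coef_map coef_poly ltn_ord /= rmorphM rmorphXn /= exprMn.
  have le_in : (i <= n)%N by rewrite -ltnS.
  have -> : a%:~R ^+ n = a%:~R ^+ (n - i) * a%:~R ^+ i :> K.
    by rewrite -exprD subnK.
  rewrite -!mulrA mulrCA; congr (_ * _).
  exact: mulrCA.
move: qx0; rewrite /root (@horner_coef_wide _ n.+2); last first.
  by rewrite size_map_inj_poly ?sqE //; apply: intr_inj.
rewrite big_ord_recr /= => /eqP qx0.
suff -> : (a%:~R * x) ^+ n.+1 + a%:~R ^+ n * \sum_(i < n.+1) (q`_i)%:~R * x ^+ i =
   a%:~R ^+ n * (\sum_(i < n.+1) (map_poly intr q)`_i * x ^+ i +
     (map_poly intr q)`_n.+1 * x ^+ n.+1).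
  by rewrite qx0 mulr0.
rewrite mulrDr addrC; congr (_ + _).
  by congr (_ * _); apply: eq_bigr => i _; rewrite coef_map.
rewrite coef_map /= exprMn exprSr mulrA; congr (_ * _ * _).
by rewrite /a lead_coefE sqE.
Qed.

(** Let [a * (i pi)] be a root of the monic integer polynomial [Q], with roots [cs]. The product
    of the [1 + cexp (c / a)] contains the factor [1 + cexp (i pi) = 0]; distributed over subsets
    it is a sum of exponentials of subset sums, among them the empty one. *)
Theorem pi_transcendental (R : realType) : transcendental (pi : R).
Proof.
move=> pi_alg; pose ipi : R[i] := Complex 0 pi.
have ipi_alg : algebraicOver (ratr : rat -> R[i]) ipi.
  have -> : ipi = 'i%C * (pi : R)%:C%C.
    by apply/eqP; rewrite eq_complex /= !mul0r !mul1r subr0 add0r !eqxx.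
  apply: algebraic_mul.
    exists ('X^2 + 1).
      by rewrite -size_poly_eq0 size_polyDl size_polyXn // size_poly1.
    by rewrite /root rmorphD rmorph1 /= map_polyXn hornerD hornerXn hornerC sqr_i addNr.
  have [p p0 /rootP ppi] := pi_alg; exists p => //.
  apply/rootP; have := congr1 (real_complex R) ppi.
  rewrite rmorph0 -horner_map -map_poly_comp /= => <-; congr (_.[_]).
  by apply: eq_map_poly => r /=; rewrite (fmorph_rat (real_complex R)).
have [a [Q [a0 monQ Qroot]]] := int_multiple_integral ipi_alg.
have [cs csE] := closed_field_poly_normal (map_poly intr Q : {poly R[i]}).
have monQC : map_poly intr Q \is @monic R[i] by apply: monic_map.
rewrite (monicP monQC) scale1r in csE.
have csQ : exists P : {poly int},
    map_poly intr P = \prod_(c <- in_tuple cs) ('X - c%:P) by exists Q.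
have [U UE] := SubsetSums.prod_subset_sums_int csQ.
have zero_sum : exists S : {set 'I_(size cs)},
    \sum_(i in S) tnth (in_tuple cs) i = 0.
  by exists finset.set0; rewrite big_set0.
have /eqP := cexp_sum_neq0 UE (SubsetSums.sum_subset_sums_int csQ) zero_sum a0.
apply; under eq_bigr do rewrite mulr_suml cexp_sum big_mkcond.
rewrite -(bigA_distr 1 +%R (fun i => cexp (tnth (in_tuple cs) i / a%:~R)) (fun=> 1)).
move: Qroot; rewrite csE root_prod_XsubC => /(nthP 0)[i lt_i csi].
rewrite (bigD1 (Ordinal lt_i)) //= (tnth_nth 0) /= csi [a%:~R * _]mulrC mulfK ?intr_eq0 //.
by rewrite cexp_ipi addNr mul0r.
Qed.

(** * Euler's integral and its functional equation *)

Section GammaIntegrals.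
Variable R : realType.
Implicit Types (s t u v x y c : R) (n k : nat).
Local Notation mu := (@lebesgue_measure R).
Local Notation I0y := (`]0%R, +oo[%classic : set R).
Local Notation seg k := (`[(k.+1%:R^-1)%R, (k.+1%:R)%R]%classic : set R).

Lemma der_continuous (f : R -> R) x y : is_derive x 1 f y -> {for x, continuous f}.
Proof.
by move=> fy; apply: differentiable_continuous; apply/derivable1_diffP; case: fy.
Qed.

Lemma der_measurable0y (f df : R -> R) :
  (forall x, 0 < x -> is_derive x 1 f (df x)) -> measurable_fun I0y f.
Proof.
move=> fdf; apply: open_continuous_measurable_fun; first exact: interval_open.
by move=> x; rewrite inE /= in_itv /= andbT => x0; apply: der_continuous (fdf x x0).
Qed.

Lemma powR_expR t s : 0 < t -> t `^ s = expR (s * ln t).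
Proof. by move=> t0; rewrite /powR gt_eqF. Qed.

Lemma bigcup_segment0y : \bigcup_k seg k = I0y.
Proof.
apply/seteqP; split => t /=.
  move=> [k _] /=; rewrite !in_itv /= andbT => /andP[kt _].
  by apply: lt_le_trans kt; rewrite invr_gt0 ltr0n.
rewrite in_itv /= andbT => t0.
pose k := maxn (Num.truncn t^-1) (Num.truncn t).
exists k => //=; rewrite in_itv /=; apply/andP; split.
  rewrite -[leRHS]invrK lef_pV2 ?posrE ?ltr0n ?invr_gt0 //.
  apply: le_trans (ltW (truncnS_gt _)) _.
  by rewrite ler_nat ltnS leq_maxl.
apply: le_trans (ltW (truncnS_gt _)) _.
by rewrite ler_nat ltnS leq_maxr.
Qed.

Lemma segment_sub0y k : seg k `<=` I0y.
Proof. by rewrite -bigcup_segment0y => t kt; exists k. Qed.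

(** Integrals over the half-line are limits of integrals over the compact segments
    [[1 / (k + 1), k + 1]], where the fundamental theorem and the change of variables apply. *)
Lemma cvg_integral_segment0y (f : R -> R) : measurable_fun I0y f ->
  (forall t, 0 < t -> 0 <= f t) ->
  (\int[mu]_(t in seg k) (f t)%:E)%E @[k --> \oo] -->
  (\int[mu]_(t in I0y) (f t)%:E)%E.
Proof.
move=> mf f0; rewrite -bigcup_segment0y.
apply: ge0_nondecreasing_set_cvg_integral => //.
- move=> m n le_mn; apply/subsetPset => t /=; rewrite !in_itv /=.
  move=> /andP[h1 h2]; apply/andP; split.
    by apply: le_trans h1; rewrite lef_pV2 ?posrE ?ltr0n // ler_nat ltnS.
  by apply: le_trans h2 _; rewrite ler_nat ltnS.
- move=> k; apply/measurable_EFinP; apply: measurable_funS mf => //.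
  exact: segment_sub0y.
- move=> k t /segment_sub0y /=; rewrite in_itv /= andbT => t0.
  by rewrite lee_fin f0.
Qed.

Lemma powR_expN_bound s : 0 <= s -> exists2 C, 0 <= C &
  forall t, 0 < t -> t `^ s * expR (- t) <= C * expR (- (t / 2)).
Proof.
move=> s0; pose m := (Num.truncn s).+1.
have sm : s <= m%:R by apply/ltW; apply: truncnS_gt.
have m0 : (0 : R) <= 2 ^+ m * m`!%:R by rewrite mulr_ge0 // exprn_ge0.
exists (1 + 2 ^+ m * m`!%:R); first by rewrite addr_ge0.
move=> t t0.
have -> : - t = - (t / 2) + - (t / 2) by field.
rewrite expRD mulrA ler_wpM2r ?expR_ge0 //.
rewrite expRN ler_pdivrMr ?expR_gt0 // mulrDl mul1r.
have e1 : 1 <= expR (t / 2) by rewrite -[leLHS](@expR0 R) ler_expR divr_ge0 // ltW.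
have em : t ^+ m <= 2 ^+ m * m`!%:R * expR (t / 2).
  (* the term of degree [m >= s] of the series of [expR (t / 2)] *)
  have := @expR_ge1Dxn R (t / 2) (Num.truncn s) (divr_ge0 (ltW t0) (ler0n _ 2)).
  rewrite -/m => le_e.
  have {le_e} : (t / 2) ^+ m / m`!%:R <= expR (t / 2).
    by apply: le_trans le_e; rewrite lerDr.
  rewrite expr_div_n ler_pdivrMr ?ltr0n ?fact_gt0 //.
  rewrite ler_pdivrMr ?exprn_gt0 // => /le_trans; apply.
  by rewrite [leLHS]mulrC [X in _ * X]mulrC mulrA.
have [t1|t1] := leP t 1.
  apply: le_trans (_ : _ <= 1) _; last first.
    by apply: le_trans e1 _; rewrite lerDl mulr_ge0 // expR_ge0.
  by rewrite -(powRr0 t) ger_powR // t0.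
apply: le_trans (_ : _ <= t ^+ m) _; last first.
  by apply: le_trans em _; rewrite lerDr expR_ge0.
by rewrite -powR_mulrn ?(ltW t0) // ler_powR // ltW.
Qed.

Lemma measurable_powR_expN s : measurable_fun I0y (fun t => t `^ s * expR (- t)).
Proof.
apply/measurable_funTS; apply: measurable_funM; first exact: measurable_powR.
by apply: measurableT_comp => //; exact: measurable_expR.
Qed.

Lemma integral_expN_half : (\int[mu]_(t in I0y) (expR (- (t / 2)))%:E < +oo)%E.
Proof.
have dF (t : R) : is_derive t 1 (fun t => - 2 * expR (- (t / 2))) (expR (- (t / 2))).
  by pderive; field.
have de (t : R) : is_derive t 1 (fun t => expR (- (t / 2))) (expR (- (t / 2)) * - 2^-1).
  by pderive; field.
rewrite integral_itv_obnd_cbnd; last first.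
  by apply/measurable_EFinP; apply: (der_measurable0y (fun t _ => de t)).
rewrite (@ge0_continuous_FTC2y _ _ (fun t => - 2 * expR (- (t / 2))) 0 0) ?ltry //.
- by apply: derivable_within_continuous => x _; case: (de x).
- rewrite -(mulr0 (-2)); apply: cvgMl_tmp.
  apply: (@cvg_comp _ _ _ (fun t : R => t / 2) (fun t => expR (- t)) _ (pinfty_nbhs R)).
    by apply: gt0_cvgMly => //; apply: cvg_id.
  exact: cvgr_expR.
- by apply: cvg_at_right_filter; apply: der_continuous (dF 0).
- by move=> x _; rewrite derive1E; case: (dF x).
Qed.

End GammaIntegrals.

Section EulerIntegral.
Variable R : realType.
Implicit Types (s t u v x y c : R) (n k : nat).
Local Notation mu := (@lebesgue_measure R).
Local Notation I0y := (`]0%R, +oo[%classic : set R).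
Local Notation seg k := (`[(k.+1%:R^-1)%R, (k.+1%:R)%R]%classic : set R).

Definition eGamma s : \bar R := (\int[mu]_(t in I0y) (t `^ (s - 1) * expR (- t))%:E)%E.

Let F s t := t `^ s * expR (- t).

Let F_ge0 s t : 0 <= F s t.
Proof. by rewrite mulr_ge0 ?powR_ge0 ?expR_ge0. Qed.

Let dF s t : 0 < t -> is_derive t 1 (F s) (s * F (s - 1) t - F s t).
Proof.
move=> t0; have dp := is_derive1_powR s t0.
by rewrite /F; pderive; ring.
Qed.

Let cvg_F_infty s : 0 <= s -> F s k.+1%:R @[k --> \oo] --> 0.
Proof.
move=> s0; have [C C0 FC] := powR_expN_bound (addr_ge0 s0 ler01).
have Fle k : F s k.+1%:R <= C * k.+1%:R^-1.
  have k0 : (0 : R) < k.+1%:R by rewrite ltr0n.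
  rewrite ler_pdivlMr //; apply: le_trans (_ : _ <= C * expR (- (k.+1%:R / 2))) _.
    apply: le_trans (FC _ k0); rewrite /F powRD ?gt_eqF ?implybT //; last first.
      by rewrite ltr_wpDl.
    by rewrite powRr1 ?ler0n // mulrAC.
  by rewrite ler_piMr // expR_le1 oppr_le0 divr_ge0.
apply: (@squeeze_cvgr _ _ _ _ (fun=> 0) (fun k => C * k.+1%:R^-1)).
- by apply: nearW => k; rewrite F_ge0 Fle.
- exact: cvg_cst.
- by rewrite -(mulr0 C); apply: cvgMl_tmp; apply: cvg_harmonic.
Qed.

Let cvg_F_zero s : 0 < s -> F s k.+1%:R^-1 @[k --> \oo] --> 0.
Proof.
move=> s0.
have hs : (k.+1%:R^-1 : R) `^ s @[k --> \oo] --> 0.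
  have /cvg_at_rightP := powR_cvg0 s0; apply; split.
    by move=> k; rewrite invr_gt0 ltr0n.
  exact: cvg_harmonic.
apply: (@squeeze_cvgr _ _ _ _ (fun=> 0) (fun k => (k.+1%:R^-1 : R) `^ s)) => //.
- apply: nearW => k; rewrite F_ge0 /F ler_piMr ?powR_ge0 //.
- exact: cvg_cst.
Qed.

(** Integration by parts on a segment, then passage to the limit; stated for the extended
    valued integral because finiteness near 0 is deduced from it in [eGamma_fin]. *)
Lemma eGammaS s : 0 < s -> eGamma (s + 1) = (s%:E * eGamma s)%E.
Proof.
move=> s0.
pose a k : R := k.+2%:R^-1; pose b k : R := k.+2%:R.
have a_gt0 k : 0 < a k by rewrite invr_gt0 ltr0n.
have lt_ab k : a k < b k.
  apply: (@lt_trans _ _ 1); last by rewrite ltr1n.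
  by rewrite invf_lt1 ?ltr1n ?ltr0n.
have gt0 k t : t \in `[a k, b k] -> 0 < t.
  by rewrite in_itv /= => /andP[at_ _]; apply: lt_le_trans at_.
have step k : (\int[mu]_(t in `[a k, b k]) (F s t)%:E + (F s (b k) - F s (a k))%:E)%E
    = (s%:E * \int[mu]_(t in `[a k, b k]) (F (s - 1) t)%:E)%E.
  have cF r : {within `[a k, b k], continuous (F r)}.
    apply: derivable_within_continuous => t /gt0 t0.
    by case: (dF r t0).
  have iF r : mu.-integrable `[a k, b k] (EFin \o F r).
    by apply: continuous_compact_integrable => //; exact: segment_compact.
  have iFs : mu.-integrable `[a k, b k] (EFin \o (fun t => s * F (s - 1) t)).
    by apply: (integrableZl _ _ (iF (s - 1))).
  have <- : (\int[mu]_(t in `[a k, b k]) (s * F (s - 1) t)%:E =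
     s%:E * \int[mu]_(t in `[a k, b k]) (F (s - 1) t)%:E)%E.
    by rewrite -integralZl //; exact: (iF (s - 1)).
  have <- : (\int[mu]_(t in `[a k, b k]) (s * F (s - 1) t - F s t)%:E =
     (F s (b k) - F s (a k))%:E)%E.
    rewrite EFinB; apply: continuous_FTC2 => //.
    - move=> t; apply: cvgB.
        by apply: cvgMl_tmp; apply: cF.
      exact: cF.
    - split.
      + move=> t tab; have t0 : 0 < t by apply: (gt0 k); apply: subset_itv_oo_cc.
        by case: (dF s t0).
      + by apply: cvg_at_right_filter; apply: der_continuous (dF s (a_gt0 k)).
      + apply: cvg_at_left_filter; apply: der_continuous (dF s _).
        exact: lt_trans (a_gt0 k) (lt_ab k).
    - move=> t tab; have t0 : 0 < t by apply: (gt0 k); apply: subset_itv_oo_cc.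
      by rewrite derive1E; case: (dF s t0).
  under [X in (_ + X)%E]eq_integral do rewrite EFinB.
  rewrite integralB //; last exact: (iF s).
  rewrite addeC subeK //; exact: integrable_fin_num (iF s).
have mF r : measurable_fun I0y (F r) by apply: measurable_powR_expN.
have lim1 r : (\int[mu]_(t in `[a k, b k]) (F r t)%:E)%E @[k --> \oo] -->
    (\int[mu]_(t in I0y) (F r t)%:E)%E.
  have := cvg_integral_segment0y (mF r) (fun t _ => F_ge0 r t).
  by rewrite -(cvg_shiftS).
have limL : (\int[mu]_(t in `[a k, b k]) (F s t)%:E + (F s (b k) - F s (a k))%:E)%E
    @[k --> \oo] --> (\int[mu]_(t in I0y) (F s t)%:E + 0%:E)%E.
  apply: cvgeD => //; first exact: fin_num_adde_defl.
  apply: cvg_EFin; first exact: nearW.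
  rewrite -[0](subr0 0); apply: cvgB.
    by have := cvg_F_infty (ltW s0); rewrite -(cvg_shiftS).
  by have := cvg_F_zero s0; rewrite -(cvg_shiftS).
have limR : (s%:E * \int[mu]_(t in `[a k, b k]) (F (s - 1) t)%:E)%E
    @[k --> \oo] --> (s%:E * \int[mu]_(t in I0y) (F (s - 1) t)%:E)%E.
  by apply: cvgeZl => //.
rewrite /eGamma addrK.
rewrite (funext step) adde0 in limL.
exact: (cvg_unique (@ereal_hausdorff R) limL limR).
Qed.

Lemma eGamma_ge0 s : (0 <= eGamma s)%E.
Proof. by apply: integral_ge0 => t _; rewrite lee_fin F_ge0. Qed.

Lemma eGamma_fin s : 0 < s -> (eGamma s < +oo)%E.
Proof.
have ge1 r : 1 <= r -> (eGamma r < +oo)%E.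
  move=> r1; have r0 : 0 <= r - 1 by rewrite subr_ge0.
  have me : measurable_fun I0y (fun t => expR (- (t / 2))).
    apply: (@der_measurable0y _ _ (fun t => expR (- (t / 2)) * - 2^-1)).
    by move=> t _; pderive; field.
  have [C C0 FC] := powR_expN_bound r0.
  apply: (@le_lt_trans _ _ (\int[mu]_(t in I0y) (C%:E * (expR (- (t / 2)))%:E))%E).
    apply: ge0_le_integral => //.
    - by move=> t _; rewrite lee_fin F_ge0.
    - by apply/measurable_EFinP; apply: measurable_powR_expN.
    - by apply: measurable_funeM; apply/measurable_EFinP.
    - by move=> t; rewrite /= in_itv /= andbT => t0; rewrite -EFinM lee_fin FC.
  rewrite ge0_integralZl //; last exact/measurable_EFinP.
  by rewrite lte_mul_pinfty ?lee_fin //; exact: integral_expN_half.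
(* the functional equation reduces [s] to [s + 1 >= 1] *)
move=> s0; have := ge1 (s + 1); rewrite lerDr => /(_ (ltW s0)).
rewrite eGammaS //; have := eGamma_ge0 s; case: (eGamma s) => [r||] //.
  by move=> *; rewrite ltry.
by rewrite gt0_muley ?lte_fin.
Qed.

Lemma powR_expN_integrable s : 0 < s ->
  mu.-integrable I0y (EFin \o (fun t => t `^ (s - 1) * expR (- t))).
Proof.
move=> s0; apply/integrableP; split.
  by apply/measurable_EFinP; apply: measurable_powR_expN.
have := eGamma_fin s0; congr (_ < _)%E; apply: eq_integral => t _.
by rewrite /= ger0_norm ?F_ge0.
Qed.

Lemma eGammaE s : 0 < s -> eGamma s = (Gamma_integral s)%:E.
Proof.
move=> s0; rewrite /Gamma_integral /Rintegral fineK //.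
exact: integrable_fin_num (powR_expN_integrable s0).
Qed.

Lemma Gamma_integralS s : 0 < s -> Gamma_integral (s + 1) = s * Gamma_integral s.
Proof.
move=> s0; have := eGammaS s0; rewrite !eGammaE ?addr_gt0 //.
by rewrite -EFinM => -[].
Qed.

End EulerIntegral.

(** * Derivatives of Euler's integral *)

Section GammaDerivatives.
Variable R : realType.
Implicit Types (s t u v x y c : R) (n k : nat).
Local Notation mu := (@lebesgue_measure R).
Local Notation I0y := (`]0%R, +oo[%classic : set R).

Definition gammaker n x t := t `^ (x - 1) * ln t ^+ n * expR (- t).

(** The [n]-th derivative of Euler's integral. *)
Definition gammaD n x := \int[mu]_(t in I0y) gammaker n x t.

Lemma gammaD0 x : gammaD 0 x = Gamma_integral x.
Proof.
rewrite /gammaD /Gamma_integral; congr fine; apply: eq_integral => t _.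
by rewrite /gammaker expr0 mulr1.
Qed.

Lemma ln_expn_bound n (e : R) : 0 < e -> exists2 C, 0 <= C &
  forall y, `|y| ^+ n <= C * expR (e * `|y|).
Proof.
move=> e0; exists (n`!%:R / e ^+ n).
  by rewrite divr_ge0 // exprn_ge0 // ltW.
move=> y; rewrite mulrAC ler_pdivlMr ?exprn_gt0 // -exprMn [`|y| * e]mulrC [_ * expR _]mulrC.
rewrite -ler_pdivrMr ?ltr0n ?fact_gt0 //.
have ey0 : 0 <= e * `|y| by rewrite mulr_ge0 // ltW.
case: n => [|n]; first by rewrite expr0 fact0 divr1 -[leLHS](@expR0 R) ler_expR.
by apply: le_trans (expR_ge1Dxn n ey0); rewrite lerDr.
Qed.

(** Domination, uniformly for [x] in [[u, v]]: a power of [ln t] costs an arbitrarily small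
    power of [t] on either side of 1, and the two Gamma integrands cover the two sides. *)
Lemma gammaker_bound n u v : 0 < u -> exists2 C, 0 <= C &
  forall x t, u <= x <= v -> 0 < t -> `|gammaker n x t| <=
    C * (t `^ (u / 2 - 1) * expR (- t) + t `^ (v + 1 - 1) * expR (- t)).
Proof.
move=> u0; pose e := Num.min (u / 2) 1.
have e0 : 0 < e by rewrite lt_min divr_gt0 ?ltr01 ?ltr0n.
have eu : e <= u / 2 by rewrite ge_min lexx.
have e1 : e <= 1 by rewrite ge_min lexx orbT.
have [C C0 HC] := ln_expn_bound n e0.
exists C => // x t /andP[ux xv] t0.
rewrite /gammaker !normrM normrX (ger0_norm (expR_ge0 _)) (ger0_norm (powR_ge0 _ _)).
rewrite -mulrDl mulrA ler_wpM2r ?expR_ge0 //.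
apply: (@le_trans _ _ (t `^ (x - 1) * (C * expR (e * `|ln t|)))).
  by rewrite ler_wpM2l ?powR_ge0.
rewrite mulrCA ler_wpM2l // !powR_expR // -expRD.
have [l0|l0] := leP (ln t) 0.
  apply: (@le_trans _ _ (expR ((u / 2 - 1) * ln t))); last by rewrite lerDl expR_ge0.
  rewrite ler_expR ler0_norm // -subr_ge0.
  have -> : (u / 2 - 1) * ln t - ((x - 1) * ln t + e * - ln t) =
    (u / 2 - x + e) * ln t by ring.
  by rewrite mulr_le0 //; lra.
apply: (@le_trans _ _ (expR ((v + 1 - 1) * ln t))); last by rewrite lerDr expR_ge0.
rewrite ler_expR gtr0_norm // -subr_ge0.
have -> : (v + 1 - 1) * ln t - ((x - 1) * ln t + e * ln t) = (v - x + (1 - e)) * ln t.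
  by ring.
by rewrite mulr_ge0 ?(ltW l0) //; lra.
Qed.

Lemma measurable_gammaker n x : measurable_fun I0y (gammaker n x).
Proof.
apply: (@der_measurable0y _ _ (fun t => (((x - 1) * t `^ (x - 1 - 1)) * ln t ^+ n +
  t `^ (x - 1) * (n%:R * ln t ^+ n.-1 * t^-1)) * expR (- t) +
  t `^ (x - 1) * ln t ^+ n * (expR (- t) * -1))) => t t0.
have dp := is_derive1_powR (x - 1) t0; have dl := is_derive1_ln t0.
by rewrite /gammaker; pderive.
Qed.

Lemma gammaker_dominant_integrable (C u v : R) : 0 < u -> 0 < v ->
  mu.-integrable I0y (EFin \o (fun t => C *
    (t `^ (u - 1) * expR (- t) + t `^ (v - 1) * expR (- t)))).
Proof.
move=> u0 v0.
have iu := powR_expN_integrable u0; have iv := powR_expN_integrable v0.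
have := integrableZl _ C (integrableD _ iu iv) => /(_ _ _); exact.
Qed.

Lemma gammaker_integrable n x : 0 < x -> mu.-integrable I0y (EFin \o gammaker n x).
Proof.
move=> x0; have [C C0 HC] := gammaker_bound n x x0.
have x20 : 0 < x / 2 by rewrite divr_gt0.
apply: (le_integrable _ _ _ (gammaker_dominant_integrable C x20 (addr_gt0 x0 ltr01))) => //.
  by apply/measurable_EFinP; exact: measurable_gammaker.
move=> t; rewrite /= in_itv /= andbT => t0; rewrite lee_fin.
apply: le_trans (HC x t _ t0) (ler_norm _).
by rewrite !lexx.
Qed.

Lemma is_derive_gammaker n t x : 0 < t ->
  is_derive x 1 (gammaker n ^~ t) (gammaker n.+1 x t).
Proof.
move=> t0; have -> : gammaker n ^~ t = fun x => expR ((x - 1) * ln t) * ln t ^+ n * expR (- t).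
  by apply/funext => y; rewrite /gammaker powR_expR.
by pderive; rewrite /gammaker powR_expR // exprS; ring.
Qed.

(** Differentiation under the integral sign; near [x] the kernels are dominated
    by their bound on [[x / 2, x + 1]]. *)
Lemma is_derive_gammaD n x : 0 < x -> is_derive x 1 (gammaD n) (gammaD n.+1 x).
Proof.
move=> x0; have x20 : 0 < x / 2 by rewrite divr_gt0.
have [C C0 HC] := gammaker_bound n.+1 (x + 1) x20.
have pos y : `]x / 2, x + 1[%classic y -> 0 < y.
  by rewrite /= in_itv /= => /andP[xy _]; apply: lt_trans xy.
have Ix : `]x / 2, x + 1[%classic x.
  by rewrite /= in_itv /=; apply/andP; split; lra.
have part y t : 0 < t -> partial1of2 (gammaker n) y t = gammaker n.+1 y t.
  by move=> t0; rewrite partial1of2E; case: (is_derive_gammaker n y t0).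
pose G t := C * (t `^ (x / 2 / 2 - 1) * expR (- t) + t `^ (x + 1 + 1 - 1) * expR (- t)).
have G0 t : 0 <= G t by rewrite mulr_ge0 // addr_ge0 // mulr_ge0 ?powR_ge0 ?expR_ge0.
have iG : mu.-integrable I0y (EFin \o G).
  by apply: gammaker_dominant_integrable; rewrite ?divr_gt0 // !addr_gt0.
have intf y : `]x / 2, x + 1[%classic y -> mu.-integrable I0y (EFin \o gammaker n y).
  by move=> /pos; exact: gammaker_integrable.
have derf y t : `]x / 2, x + 1[%classic y -> I0y t -> derivable (gammaker n ^~ t) y 1.
  rewrite /= !in_itv /= andbT => _ t0.
  by case: (is_derive_gammaker n y t0).
have Gub y t : `]x / 2, x + 1[%classic y -> I0y t ->
    `|partial1of2 (gammaker n) y t| <= G t.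
  rewrite /= !in_itv /= andbT => /andP[/ltW h1 /ltW h2] t0.
  by rewrite part // HC // h1 h2.
apply: DeriveDef.
  exact: (derivable_under_integral _ Ix intf derf G0 iG Gub).
rewrite -derive1E (differentiation_under_integral _ Ix intf derf G0 iG Gub) //.
apply: eq_Rintegral => t; rewrite inE /= in_itv /= andbT => t0.
by rewrite part.
Qed.

End GammaDerivatives.

(** * The product of two Euler integrals *)

Section EulerReflection.
Variable R : realType.
Implicit Types (s t u v x y c : R) (n k : nat).
Local Notation mu := (@lebesgue_measure R).
Local Notation I0y := (`]0%R, +oo[%classic : set R).

Lemma continuous_measurable0y (f : R -> R) :
  (forall x, 0 < x -> {for x, continuous f}) -> measurable_fun I0y f.
Proof.
move=> cf; apply: open_continuous_measurable_fun; first exact: interval_open.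
by move=> x; rewrite inE /= in_itv /= andbT => x0; apply: cf.
Qed.

Lemma continuous_within_pos (f : R -> R) (a b : R) : 0 < a ->
  (forall x, 0 < x -> {for x, continuous f}) -> {within `[a, b], continuous f}.
Proof.
move=> a0 cf; apply: continuous_in_subspaceT => x.
by rewrite inE /= in_itv /= => /andP[ax _]; apply: cf; apply: lt_le_trans ax.
Qed.

(** The increasing change of variables on segments, exhausted to the half-line on both sides
    at once. *)
Lemma integration_by_substitution0y (F dF G : R -> R) :
  (forall x, 0 < x -> 0 < F x) ->
  (forall x y, 0 < x -> x < y -> F x < F y) ->
  (forall y, 0 < y -> exists2 x, 0 < x & F x = y) ->
  (forall x, 0 < x -> is_derive x 1 F (dF x)) ->
  (forall x, 0 < x -> 0 <= dF x) ->
  (forall x, 0 < x -> {for x, continuous dF}) ->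
  (forall x, 0 < x -> {for x, continuous G}) ->
  (forall x, 0 < x -> 0 <= G x) ->
  (\int[mu]_(y in I0y) (G y)%:E = \int[mu]_(x in I0y) (G (F x) * dF x)%:E)%E.
Proof.
move=> F0 F_incr F_onto FdF dF0 cdF cG G0.
have cF x : 0 < x -> {for x, continuous F} by move=> /FdF; apply: der_continuous.
have cGF x : 0 < x -> {for x, continuous (fun x => G (F x) * dF x)}.
  move=> x0; apply: cvgM; last exact: cdF.
  by apply: continuous_comp; [exact: cF|apply: cG; exact: F0].
pose a k : R := k.+1%:R^-1; pose b k : R := k.+1%:R.
have a0 k : 0 < a k by rewrite invr_gt0 ltr0n.
have b0 k : 0 < b k by rewrite ltr0n.
have le_ab k : a k <= b k.
  by apply: (@le_trans _ _ 1); rewrite ?ler1n // invf_le1 ?ler1n ?ltr0n.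
have F_le x y : 0 < x -> x <= y -> F x <= F y.
  by move=> x0; rewrite le_eqVlt => /predU1P[->//|/(F_incr _ _ x0)/ltW].
have lhs : (\int[mu]_(y in `[F (a k), F (b k)]) (G y)%:E)%E @[k --> \oo] -->
    (\int[mu]_(y in I0y) (G y)%:E)%E.
  have -> : I0y = \bigcup_k `[F (a k), F (b k)]%classic.
    apply/seteqP; split => y; rewrite /= in_itv /= andbT.
      move=> /F_onto[x x0 <-].
      have : I0y x by rewrite /= in_itv /= andbT.
      rewrite -bigcup_segment0y => -[k _] /=; rewrite in_itv /= => /andP[ax xb].
      by exists k => //=; rewrite in_itv /= !F_le // a0.
    move=> [k _] /=; rewrite !in_itv /= => /andP[Fy _].
    by apply: lt_le_trans Fy; apply: F0.
  apply: ge0_nondecreasing_set_cvg_integral => //.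
  - move=> m n le_mn; apply/subsetPset => y /=; rewrite !in_itv /=.
    move=> /andP[h1 h2]; apply/andP; split.
      apply: le_trans h1; apply: F_le => //.
      by rewrite lef_pV2 ?posrE ?ltr0n // ler_nat ltnS.
    by apply: le_trans h2 _; apply: F_le => //; rewrite ler_nat ltnS.
  - move=> k; apply/measurable_EFinP.
    apply: measurable_funS (continuous_measurable0y cG) => // y /=.
    rewrite !in_itv /= andbT => /andP[Fy _].
    by apply: lt_le_trans Fy; apply: F0.
  - move=> k y /=; rewrite in_itv /= => /andP[Fy _]; rewrite lee_fin G0 //.
    by apply: lt_le_trans Fy; apply: F0.
have rhs := @cvg_integral_segment0y _ _ (continuous_measurable0y cGF).
have {}rhs := rhs (fun x (x0 : 0 < x) => mulr_ge0 (G0 _ (F0 _ x0)) (dF0 x x0)).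
suff step : (fun k => \int[mu]_(y in `[F (a k), F (b k)]) (G y)%:E)%E =
   (fun k => \int[mu]_(x in `[a k, b k]) (G (F x) * dF x)%:E)%E.
  rewrite step in lhs; exact: (cvg_unique (@ereal_hausdorff R) lhs rhs).
apply/funext => k.
have F'E x : 0 < x -> F^`()%classic x = dF x.
  by move=> x0; rewrite derive1E; case: (FdF x x0).
have cF' x : 0 < x -> F^`()%classic y @[y --> x] --> dF x.
  move=> x0; apply: cvg_trans (cdF x x0); apply: near_eq_cvg.
  near=> y; rewrite F'E //; near: y; exact: lt_nbhsr.
rewrite integration_by_substitution_increasing //.
- apply: eq_integral => x; rewrite inE /= in_itv /= => /andP[ax _].
  by rewrite /= -[in RHS]F'E // (lt_le_trans _ ax).
- move=> x y; rewrite !in_itv /= => /andP[ax _] _.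
  by apply: F_incr; apply: lt_le_trans ax.
- move=> x; rewrite in_itv /= => /andP[ax _]; have x0 := lt_trans (a0 k) ax.
  by rewrite /continuous_at F'E //; exact: cF'.
- by apply/cvg_ex; exists (dF (a k)); apply: cvg_at_right_filter; exact: cF'.
- by apply/cvg_ex; exists (dF (b k)); apply: cvg_at_left_filter; exact: cF'.
- split.
  + move=> x; rewrite in_itv /= => /andP[ax _]; have x0 := lt_trans (a0 k) ax.
    by case: (FdF x x0).
  + by apply: cvg_at_right_filter; exact: cF.
  + by apply: cvg_at_left_filter; exact: cF.
- by apply: continuous_within_pos => //; exact: F0.
Unshelve. all: end_near. Qed.

Lemma integral_dilation (G : R -> R) c : 0 < c ->
  (forall x, 0 < x -> {for x, continuous G}) -> (forall x, 0 < x -> 0 <= G x) ->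
  (\int[mu]_(y in I0y) (G y)%:E = \int[mu]_(x in I0y) (G (c * x) * c)%:E)%E.
Proof.
move=> c0 cG G0.
apply: (@integration_by_substitution0y (fun x => c * x) (fun=> c)) => //.
- by move=> x x0; rewrite mulr_gt0.
- by move=> x y _ xy; rewrite ltr_pM2l.
- by move=> y y0; exists (c^-1 * y); rewrite ?mulr_gt0 ?invr_gt0 // mulVKf ?gt_eqF.
- by move=> x _; pderive; ring.
- by move=> x _; exact: ltW.
- by move=> x _; exact: cvg_cst.
Qed.

Lemma measurable_dilation (G : R -> R) c : 0 < c ->
  (forall x, 0 < x -> {for x, continuous G}) ->
  measurable_fun I0y (fun x => G (c * x) * c).
Proof.
move=> c0 cG; apply: continuous_measurable0y => x x0.
apply: cvgM; last exact: cvg_cst.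
apply: continuous_comp; last by apply: cG; rewrite mulr_gt0.
by apply: cvgMl_tmp; exact: cvg_id.
Qed.

Lemma eGamma1 : eGamma 1 = 1%E :> \bar R.
Proof.
rewrite /eGamma integral_itv_obnd_cbnd; last first.
  by apply/measurable_EFinP; exact: measurable_powR_expN.
under eq_integral do rewrite subrr powRr0 mul1r.
have de t : is_derive t 1 (fun t => expR (- t)) (- expR (- t)) by pderive; ring.
have dF t : is_derive t 1 (fun t => - expR (- t)) (expR (- t)) by pderive; ring.
rewrite (@ge0_continuous_FTC2y _ _ (fun t => - expR (- t)) 0 0) //.
- by rewrite oppr0 expR0 -EFinB sub0r opprK.
- by apply: derivable_within_continuous => x _; case: (de x).
- by rewrite -oppr0; apply: cvgN; exact: cvgr_expR.
- by apply: cvg_at_right_filter; apply: der_continuous (dF 0).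
- by move=> x _; rewrite derive1E; case: (dF x).
Qed.

(** Tonelli applied to [u^(x-1) e^(-t(1+u))]: integrating first in [u] gives the
    product of two Gamma values, integrating first in [t] an elementary kernel. *)
Lemma eGamma_reflection x : 0 < x < 1 ->
  (eGamma x * eGamma (1 - x) = \int[mu]_(u in I0y) (u `^ (x - 1) / (1 + u))%:E)%E.
Proof.
move=> /andP[x0 x1].
pose h t u := u `^ (x - 1) * expR (- (t * (1 + u))).
have h0 t u : 0 <= h t u by rewrite mulr_ge0 ?powR_ge0 ?expR_ge0.
have inner_u t : 0 < t -> (\int[mu]_(u in I0y) (h t u)%:E =
    (t `^ ((1 - x) - 1) * expR (- t))%:E * eGamma x)%E.
  move=> t0.
  have cg u : 0 < u -> {for u, continuous (fun u => u `^ (x - 1) * expR (- u))}.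
    move=> u0; have dp := is_derive1_powR (x - 1) u0.
    apply: (@der_continuous _ _ _ ((x - 1) * u `^ (x - 1 - 1) * expR (- u) -
      u `^ (x - 1) * expR (- u))).
    by pderive; ring.
  have g0 u : 0 < u -> 0 <= u `^ (x - 1) * expR (- u).
    by move=> _; rewrite mulr_ge0 ?powR_ge0 ?expR_ge0.
  rewrite [eGamma x](integral_dilation t0 cg g0) -ge0_integralZl //; last 3 first.
  - by apply/measurable_EFinP; exact: (measurable_dilation t0 cg).
  - by move=> u _; rewrite lee_fin !mulr_ge0 ?powR_ge0 ?expR_ge0 // ltW.
  - by rewrite lee_fin mulr_ge0 ?powR_ge0 ?expR_ge0.
  apply: eq_integral => u; rewrite inE /= in_itv /= andbT => u0.
  rewrite -EFinM; congr EFin.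
  rewrite /h !powR_expR ?mulr_gt0 // lnM ?posrE //.
  have tE : t = expR (ln t) by rewrite lnK ?posrE.
  rewrite [X in _ * X = _]/= [X in _ = _ * (_ * X)]tE -!expRD; congr expR.
  ring.
have inner_t u : 0 < u -> (\int[mu]_(t in I0y) (h t u)%:E =
    (u `^ (x - 1) / (1 + u))%:E)%E.
  move=> u0; have u10 : 0 < 1 + u by rewrite addr_gt0.
  have := eGamma1; rewrite /eGamma subrr.
  have cg t : 0 < t -> {for t, continuous (fun t => t `^ 0 * expR (- t))}.
    move=> t0; apply: (@der_continuous _ _ _ (- expR (- t))).
    have -> : (fun t => t `^ 0 * expR (- t)) = (fun t : R => expR (- t)).
      by apply/funext => r; rewrite powRr0 mul1r.
    by pderive; ring.
  have g0 t : 0 < t -> 0 <= t `^ 0 * expR (- t).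
    by move=> _; rewrite mulr_ge0 ?powR_ge0 ?expR_ge0.
  rewrite (integral_dilation u10 cg g0) => I1.
  rewrite -[RHS]mule1 -I1 -ge0_integralZl //; last 3 first.
  - by apply/measurable_EFinP; exact: (measurable_dilation u10 cg).
  - by move=> t _; rewrite lee_fin !mulr_ge0 ?powR_ge0 ?expR_ge0 // ltW.
  - by rewrite lee_fin divr_ge0 ?powR_ge0 // ltW.
  apply: eq_integral => t _; rewrite -EFinM; congr EFin.
  rewrite /h powRr0 mul1r [t * _]mulrC; field.
  by rewrite gt_eqF.
pose f (z : R * R) : \bar R := (\1_I0y z.1 * \1_I0y z.2 * h z.1 z.2)%:E.
have mf : measurable_fun setT f.
  apply/measurable_EFinP; apply: measurable_funM.
    apply: measurable_funM; (apply: measurableT_comp; first exact: measurable_indic).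
      exact: measurable_fst.
    exact: measurable_snd.
  apply: measurable_funM.
    exact: (measurableT_comp (measurable_powR (x - 1)) measurable_snd).
  apply: (measurableT_comp (@measurable_expR R)).
  apply: measurableT_comp => //; apply: measurable_funM; first exact: measurable_fst.
  by apply: measurable_funD => //; exact: measurable_snd.
have f0 z : (0 <= f z)%E by rewrite lee_fin mulr_ge0 // ?h0 // !indicE mulr_ge0 ?ler0n.
have restrict (g : R -> R) : (\int[mu]_y (\1_I0y y * g y)%:E =
    \int[mu]_(y in I0y) (g y)%:E)%E.
  rewrite [RHS]integral_mkcond; apply: eq_integral => y _.
  by rewrite patchE indicE; case: ifP => _; rewrite ?mul1r ?mul0r.
have := @fubini_tonelli _ _ _ _ R mu mu f mf f0.
have -> : (\int[mu]_t \int[mu]_u f (t, u) = eGamma x * eGamma (1 - x))%E.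
  transitivity (\int[mu]_(t in I0y) ((t `^ (1 - x - 1) * expR (- t))%:E * eGamma x))%E.
    rewrite [RHS]integral_mkcond; apply: eq_integral => t _.
    under eq_integral do rewrite /f /= mulrAC mulrC.
    rewrite restrict patchE; case: ifPn => It.
      rewrite -inner_u; last by move: It; rewrite inE /= in_itv /= andbT.
      by apply: eq_integral => u _; rewrite indicE It mul1r.
    by apply: integral0_eq => u _; rewrite indicE (negbTE It) mul0r.
  rewrite [RHS]muleC.
  apply: ge0_integralZr (eGamma_ge0 x) => //.
  - by apply/measurable_EFinP; exact: measurable_powR_expN.
  - by move=> t _; rewrite lee_fin mulr_ge0 ?powR_ge0 ?expR_ge0.
move=> ->; transitivity (\int[mu]_(u in I0y) \int[mu]_(t in I0y) (h t u)%:E)%E.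
  rewrite [RHS]integral_mkcond; apply: eq_integral => u _.
  under eq_integral do rewrite /f /= -mulrA.
  rewrite restrict patchE; case: ifPn => Iu.
    by apply: eq_integral => t _; rewrite indicE Iu mul1r.
  by apply: integral0_eq => t _; rewrite indicE (negbTE Iu) mul0r.
apply: eq_integral => u; rewrite inE /= in_itv /= andbT => u0.
exact: inner_t.
Qed.

End EulerReflection.

(** * Herglotz' trick and the trisection of the cosecant *)

(** Herglotz' trick: the maximum of [|d|], if attained at [y], is attained at
    [y / 3], [y / 9] and so on, because in the functional equation the three
    terms on the right are at most that maximum. *)
Lemma herglotz (R : realType) (d : R -> R) :
  (forall x, 0 < x < 1 -> {for x, continuous d}) ->
  d x @[x --> 0^'+] --> 0 ->
  (forall x, 0 < x < 1 -> d (1 - x) = d x) ->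
  (forall x, 0 < x < 1 -> 3 * d x = d (x / 3) - d ((x + 1) / 3) + d ((x + 2) / 3)) ->
  forall x, 0 < x < 1 -> d x = 0.
Proof.
move=> cd d0 d_sym d_triple x0 x01; apply/eqP; apply/negP => /negP dx0.
have dx0_gt0 : 0 < `|d x0| by rewrite normr_gt0.
(* near the end points [|d|] is smaller than [|d x0|] *)
have [e e0 small] : exists2 e, 0 < e & forall x, 0 < x < e -> `|d x| < `|d x0|.
  move/cvgrPdist_lt : d0 => /(_ _ dx0_gt0); rewrite near_withinE.
  move=> /nbhs_ballP[e /= e0 He]; exists e => // x /andP[x_gt0 xe].
  have := He x; rewrite /ball /= sub0r normrN => /(_ _ x_gt0).
  by rewrite sub0r normrN; apply; rewrite gtr0_norm.
have far x : 0 < x < 1 -> `|d x0| <= `|d x| -> e <= x <= 1 - e.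
  move=> /andP[x_gt0 x_lt1] le_d; apply/andP; split.
    by rewrite leNgt; apply/negP => xe; have := small x; rewrite x_gt0 xe ltNge le_d => /(_ isT).
  rewrite leNgt; apply/negP => xe; have := small (1 - x).
  rewrite d_sym ?x_gt0 // (ltNge `|d x|) le_d => /(_ _)/notF; apply.
  by apply/andP; split; lra.
have /andP[ex0 x0e] := far _ x01 (lexx _).
have cN : {within `[e, 1 - e], continuous (fun x => `|d x|)}.
  apply: continuous_in_subspaceT => x; rewrite inE /= in_itv /= => /andP[ex xe].
  apply: continuous_comp; last exact: norm_continuous.
  by apply: cd; apply/andP; split; lra.
have [y] := EVT_max (le_trans ex0 x0e) cN.
rewrite in_itv /= => /andP[ey ye] y_max.
have y01 : 0 < y < 1 by apply/andP; split; lra.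
have dy_ge : `|d x0| <= `|d y| by apply: y_max; rewrite in_itv /= ex0.
have max_all x : 0 < x < 1 -> `|d x| <= `|d y|.
  move=> hx; have [lt_d|le_d] := ltP `|d x| `|d x0|.
    exact: le_trans (ltW lt_d) dy_ge.
  by apply: y_max; rewrite in_itv /=; exact: far.
have third x : 0 < x < 1 -> `|d x| = `|d y| -> `|d (x / 3)| = `|d y|.
  move=> /andP[hx1 hx2] xE; apply/eqP; rewrite eq_le max_all /=; last first.
    by apply/andP; split; lra.
  have m1 : `|d ((x + 1) / 3)| <= `|d y| by apply: max_all; apply/andP; split; lra.
  have m2 : `|d ((x + 2) / 3)| <= `|d y| by apply: max_all; apply/andP; split; lra.
  have : `|3 * d x| = 3 * `|d y| by rewrite normrM xE ger0_norm.
  rewrite d_triple ?hx1 // => E.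
  have := ler_normD (d (x / 3) - d ((x + 1) / 3)) (d ((x + 2) / 3)).
  have := ler_normB (d (x / 3)) (d ((x + 1) / 3)).
  rewrite E; lra.
have iter k : (0 < y / 3 ^+ k < 1) /\ `|d (y / 3 ^+ k)| = `|d y|.
  elim: k => [|k [/andP[h1 h2] IHk]]; first by rewrite expr0 divr1.
  have -> : y / 3 ^+ k.+1 = y / 3 ^+ k / 3 by rewrite exprSr invfM mulrA.
  split; last by apply: third; rewrite ?h1.
  by apply/andP; split; lra.
have lim0 : (3^-1 : R) ^+ k @[k --> \oo] --> 0.
  by apply: cvg_expr; rewrite ger0_norm ?invr_ge0 // invf_lt1 // ltr1n.
have /cvgrPdist_lt/(_ _ e0)[k _ /(_ k (leqnn k))] := lim0.
rewrite sub0r normrN ger0_norm ?exprn_ge0 ?invr_ge0 // => lt_ke.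
have [h1 h2] := iter k; have := small (y / 3 ^+ k).
move/andP: h1 => [h1 _]; rewrite h1 /= h2 (ltNge `|d y|) dy_ge => /(_ _)/notF; apply.
rewrite -exprVn; apply: le_lt_trans lt_ke.
rewrite ler_piMl ?exprn_ge0 ?invr_ge0 //.
by case/andP: y01 => _ /ltW.
Qed.

Section CosecantTriple.
Variable R : realType.
Implicit Types (x y : R).

Lemma cos_triple x : cos (x *+ 2 + x) = 4 * cos x ^+ 3 - 3 * cos x.
Proof.
rewrite cosD cos_mulr2n sin_mulr2n; have := sin2cos2 x.
move: (cos x) (sin x) => c s s2.
have -> : (c ^+ 2 *+ 2 - 1) * c - (c * s) *+ 2 * s =
  (c ^+ 2 *+ 2 - 1) * c - (s ^+ 2 * c) *+ 2 by ring.
by rewrite s2; ring.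
Qed.

Lemma sin_triple x : sin (x *+ 2 + x) = 3 * sin x - 4 * sin x ^+ 3.
Proof.
rewrite sinD cos_mulr2n sin_mulr2n; have := cos2sin2 x.
move: (cos x) (sin x) => c s c2.
have -> : (c * s) *+ 2 * c + (c ^+ 2 *+ 2 - 1) * s =
  (c ^+ 2 * s) *+ 2 + (c ^+ 2 *+ 2 - 1) * s by ring.
by rewrite c2; ring.
Qed.

(** The value is the positive root of [4 c^3 - 3 c = cos pi = -1], that is of
    [(c + 1) (2 c - 1)^2 = 0]. *)
Lemma cos_pi_third : cos (pi / 3) = 2^-1 :> R.
Proof.
have c0 : 0 < cos (pi / 3 : R).
  by apply: cos_gt0_pihalf; have := @pi_gt0 R; move=> p0; apply/andP; split; lra.
have := cos_triple (pi / 3).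
have -> : (pi / 3) *+ 2 + pi / 3 = pi :> R by field.
rewrite cospi; move: (cos _) c0 => c c0 E.
have : (c + 1) * (2 * c - 1) ^+ 2 = 0.
  have -> : (c + 1) * (2 * c - 1) ^+ 2 = 4 * c ^+ 3 - 3 * c + 1 by ring.
  by rewrite -E addNr.
move=> /eqP; rewrite mulf_eq0 sqrf_eq0 => /orP[/eqP|/eqP] h; lra.
Qed.

(** By the addition formulas the three sines on the right are [p], [S c + p / 2] and
    [S c - p / 2] with [p] and [c] the sine and cosine of [pi x / 3] and [S = sin (pi / 3)],
    and the one on the left is four times their product. *)
Lemma csc_triple x : 0 < x < 1 ->
  3 * (pi / sin (pi * x)) = pi / sin (pi * (x / 3)) -
    pi / sin (pi * ((x + 1) / 3)) + pi / sin (pi * ((x + 2) / 3)) :> R.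
Proof.
move=> /andP[x0 x1]; have p0 := @pi_gt0 R.
have spos y : 0 < y < 1 -> 0 < sin (pi * y).
  by move=> /andP[y0 y1]; apply: sin_gt0_pi; rewrite mulr_gt0 //= gtr_pMr.
have s1 : 0 < sin (pi * x) by apply: spos; rewrite x0.
have s2 : 0 < sin (pi * (x / 3)) by apply: spos; apply/andP; split; lra.
have s3 : 0 < sin (pi * ((x + 1) / 3)) by apply: spos; apply/andP; split; lra.
have s4 : 0 < sin (pi * ((x + 2) / 3)) by apply: spos; apply/andP; split; lra.
have e1 : sin (pi * x) = 3 * sin (pi * (x / 3)) - 4 * sin (pi * (x / 3)) ^+ 3.
  by rewrite -sin_triple; congr sin; field.
have e3 : sin (pi * ((x + 1) / 3)) =
    sin (pi * (x / 3)) / 2 + sin (pi / 3) * cos (pi * (x / 3)).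
  have -> : pi * ((x + 1) / 3) = pi * (x / 3) + pi / 3 by field.
  by rewrite sinD cos_pi_third [X in _ + X]mulrC.
have e4 : sin (pi * ((x + 2) / 3)) =
    sin (pi / 3) * cos (pi * (x / 3)) - sin (pi * (x / 3)) / 2.
  have -> : pi * ((x + 2) / 3) = pi - (pi / 3 - pi * (x / 3)) by field.
  rewrite sinB sinpi cospi mul0r sub0r mulN1r opprK sinB cos_pi_third.
  by rewrite [X in _ - X]mulrC.
have := cos2sin2 (pi * (x / 3)).
have : sin (pi / 3 : R) ^+ 2 = 3 / 4 by rewrite sin2cos2 cos_pi_third; field.
rewrite e1 in s1 *; rewrite e3 in s3 *; rewrite e4 in s4 *.
move: (pi : R) (sin (pi / 3)) (sin (pi * (x / 3))) (cos (pi * (x / 3))) s1 s2 s3 s4.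
move=> P S p c s1 s2 s3 s4 S2 c2.
have prod : 3 * p - 4 * p ^+ 3 = 4 * (p * (p / 2 + S * c) * (S * c - p / 2)).
  have -> : 4 * (p * (p / 2 + S * c) * (S * c - p / 2)) =
    4 * p * (S ^+ 2 * c ^+ 2 - p ^+ 2 / 4) by field.
  by rewrite S2 c2; field.
rewrite prod.
have num : (p / 2 + S * c) * (S * c - p / 2) - p * (S * c - p / 2) + p * (p / 2 + S * c) = 3 / 4.
  have -> : (p / 2 + S * c) * (S * c - p / 2) - p * (S * c - p / 2) + p * (p / 2 + S * c)
    = S ^+ 2 * c ^+ 2 + p ^+ 2 * (3 / 4) by field.
  by rewrite S2 c2; field.
move: s2 s3 s4 num; move: p (p / 2 + S * c) (S * c - p / 2) {s1 prod c2} => u v w u0 v0 w0 num.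
have -> : 3 = 4 * (v * w - u * w + u * v) :> R by rewrite num; field.
by field; rewrite !gt_eqF.
Qed.

End CosecantTriple.

(** * Euler's reflection formula *)

Section GammaReflection.
Variable R : realType.
Implicit Types (s t u v x y c : R) (n k : nat).
Local Notation mu := (@lebesgue_measure R).
Local Notation I0y := (`]0%R, +oo[%classic : set R).

Lemma continuous_powR_div (a : R) n u : 0 < u ->
  {for u, continuous (fun u => u `^ a / (1 + u ^+ n))}.
Proof.
move=> u0; apply: cvgM.
  exact: der_continuous (is_derive1_powR a u0).
have dn : is_derive u 1 (fun u => 1 + u ^+ n) (n%:R * u ^+ n.-1) by pderive; ring.
apply: cvgV; last exact: der_continuous dn.
by rewrite gt_eqF // ltr_wpDr // exprn_ge0 // ltW.
Qed.

Let ker_ge0 (a : R) n u : 0 < u -> 0 <= u `^ a / (1 + u ^+ n).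
Proof.
move=> u0; rewrite divr_ge0 ?powR_ge0 // addr_ge0 // exprn_ge0 //; exact: ltW.
Qed.

Let measurable_ker (a : R) n : measurable_fun I0y (fun u => u `^ a / (1 + u ^+ n)).
Proof. by apply: continuous_measurable0y => u; exact: continuous_powR_div. Qed.

(** The substitution [u = v^3]. *)
Lemma integral_cube_ker p : (\int[mu]_(u in I0y) (u `^ (p / 3 - 1) / (1 + u))%:E =
  \int[mu]_(v in I0y) (3 * (v `^ (p - 1) / (1 + v ^+ 3)))%:E)%E.
Proof.
transitivity (\int[mu]_(v in I0y)
    ((v ^+ 3) `^ (p / 3 - 1) / (1 + (v ^+ 3) ^+ 1) * (3 * v ^+ 2))%:E)%E; last first.
  apply: eq_integral => v; rewrite inE /= in_itv /= andbT => v0; congr EFin.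
  rewrite expr1 !powR_expR ?exprn_gt0 // lnXn // mulrAC [RHS]mulrA; congr (_ / _).
  have v2 : v ^+ 2 = expR (ln v *+ 2) by rewrite -lnXn // lnK ?posrE ?exprn_gt0.
  rewrite v2 mulrC -mulrA -expRD; congr (_ * expR _).
  by field.
apply: (@integration_by_substitution0y R (fun v => v ^+ 3) (fun v => 3 * v ^+ 2)
   (fun u => u `^ (p / 3 - 1) / (1 + u ^+ 1))).
- by move=> v v0; rewrite exprn_gt0.
- by move=> v w v0 vw; rewrite ltrXn2r // ?ltW // (lt_trans v0).
- move=> y y0; exists (expR (ln y / 3)); first exact: expR_gt0.
  by rewrite -expRM_natl mulrC divfK // lnK ?posrE.
- by move=> v v0; pderive; rewrite /=; ring.
- by move=> v v0; rewrite mulr_ge0 // exprn_ge0 // ltW.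
- move=> v v0; apply: (@der_continuous _ _ _ (3 * (2 * v))).
  by pderive; rewrite /=; ring.
- by move=> v; exact: continuous_powR_div.
- by move=> v; exact: ker_ge0.
Qed.

Let integral0yD (f g : R -> R) :
  measurable_fun I0y f -> (forall u, 0 < u -> 0 <= f u) ->
  measurable_fun I0y g -> (forall u, 0 < u -> 0 <= g u) ->
  (\int[mu]_(u in I0y) (f u + g u)%:E =
   \int[mu]_(u in I0y) (f u)%:E + \int[mu]_(u in I0y) (g u)%:E)%E.
Proof.
move=> mf f0 mg g0.
have pos (h : R -> R) : (forall u, 0 < u -> 0 <= h u) ->
    forall u, I0y u -> (0 <= (h u)%:E)%E.
  by move=> h0 u; rewrite /= in_itv /= andbT lee_fin; exact: h0.
apply: (@ge0_integralD _ _ _ mu I0y _ (EFin \o f) (EFin \o g)) => //.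
- exact: pos.
- exact/measurable_EFinP.
- exact: pos.
- exact/measurable_EFinP.
Qed.

Definition eBeta x := (eGamma x * eGamma (1 - x))%E.

(** In the variable [v] with [u = v^3], this is the partial fraction identity
    [3 / (1 + v) + 3 v / (1 + v^3) = (3 + 3 v^2) / (1 + v^3)]. *)
Lemma eBeta_triple y : 0 < y < 1 ->
  (3%:E * eBeta y + eBeta ((y + 1) / 3) = eBeta (y / 3) + eBeta ((y + 2) / 3))%E.
Proof.
move=> y01; have /andP[y0 y1] := y01.
have h0 : 0 < y / 3 < 1 by apply/andP; split; lra.
have h1 : 0 < (y + 1) / 3 < 1 by apply/andP; split; lra.
have h2 : 0 < (y + 2) / 3 < 1 by apply/andP; split; lra.
have e : eBeta y = _ := eGamma_reflection y01.
have e0 : eBeta (y / 3) = _ := etrans (eGamma_reflection h0) (integral_cube_ker y).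
have e1 : eBeta ((y + 1) / 3) = _ :=
  etrans (eGamma_reflection h1) (integral_cube_ker (y + 1)).
have e2 : eBeta ((y + 2) / 3) = _ :=
  etrans (eGamma_reflection h2) (integral_cube_ker (y + 2)).
rewrite e e0 e1 e2.
pose k1 u := 3 * (u `^ (y - 1) / (1 + u ^+ 1)).
pose k3 (a u : R) := 3 * (u `^ a / (1 + u ^+ 3)).
have mk1 : measurable_fun I0y k1.
  by apply: measurable_funM => //; exact: measurable_ker.
have k1_ge0 u : 0 < u -> 0 <= k1 u by move=> u0; rewrite mulr_ge0 // ker_ge0.
have mk3 a : measurable_fun I0y (k3 a).
  by apply: measurable_funM => //; exact: measurable_ker.
have k3_ge0 a u : 0 < u -> 0 <= k3 a u by move=> u0; rewrite mulr_ge0 // ker_ge0.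
have E1 : (\int[mu]_(u in I0y) (k1 u)%:E =
    3%:E * \int[mu]_(u in I0y) (u `^ (y - 1) / (1 + u))%:E)%E.
  have mk : measurable_fun I0y (fun u => (u `^ (y - 1) / (1 + u ^+ 1))%:E).
    by apply/measurable_EFinP; exact: measurable_ker.
  have kpos u : I0y u -> (0 <= (u `^ (y - 1) / (1 + u ^+ 1))%:E)%E.
    by rewrite /= in_itv /= andbT lee_fin => u0; exact: ker_ge0.
  exact: (@ge0_integralZl _ _ _ mu I0y (measurable_itv _) _ mk 3%:E kpos).
transitivity (\int[mu]_(u in I0y) (k1 u + k3 (y + 1 - 1) u)%:E)%E.
  by rewrite (integral0yD mk1 k1_ge0 (mk3 _) (k3_ge0 _)) E1.
transitivity (\int[mu]_(u in I0y) (k3 (y - 1) u + k3 (y + 2 - 1) u)%:E)%E; last first.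
  exact: (integral0yD (mk3 _) (k3_ge0 _) (mk3 _) (k3_ge0 _)).
apply: eq_integral => u; rewrite inE /= in_itv /= andbT => u0; congr EFin.
rewrite /k1 /k3.
have -> : u `^ (y + 1 - 1) = u `^ (y - 1) * u.
  rewrite -[X in _ * X]powRr1 ?ltW // -powRD ?(gt_eqF u0) ?implybT //.
  by congr (_ `^ _); ring.
have -> : u `^ (y + 2 - 1) = u `^ (y - 1) * u ^+ 2.
  rewrite -powR_mulrn ?ltW // -powRD ?(gt_eqF u0) ?implybT //.
  by congr (_ `^ _); ring.
have n1 : 1 + u != 0 by rewrite gt_eqF // addr_gt0.
have n3 : 1 + u ^+ 3 != 0 by rewrite gt_eqF // addr_gt0 // exprn_gt0.
by rewrite expr1; field; rewrite n1 n3.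
Qed.

Local Notation G := (@Gamma_integral R).

Lemma is_derive_Gamma_integral x : 0 < x -> is_derive x 1 G (gammaD 1 x).
Proof.
have -> : G = gammaD 0 by apply/funext => y; rewrite gammaD0.
exact: is_derive_gammaD.
Qed.

Lemma sin_lower_bounds y : 0 <= y <= 1 -> `|sin y - y| <= y ^+ 3 /\ y / 2 <= sin y.
Proof.
move=> y01.
have s1 v : 0 <= v <= 1 -> `|sin v| <= 1 / 1%:R * v ^+ 1.
  apply: (@normr_le_of_derive _ sin cos); first exact: sin0.
  by move=> u _; rewrite expr0 mulr1 cos_max.
have s2 v : 0 <= v <= 1 -> `|cos v - 1| <= 1 / 1%:R / 2%:R * v ^+ 2.
  apply: (@normr_le_of_derive _ (fun u => cos u - 1) (fun u => - sin u)).
  - by rewrite cos0 subrr.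
  - by move=> u; pderive; ring.
  - by move=> u u01; rewrite normrN; exact: s1.
have s3 : `|sin y - y| <= 1 / 1%:R / 2%:R / 3%:R * y ^+ 3.
  apply: (@normr_le_of_derive _ (fun u => sin u - u) (fun u => cos u - 1)) => //.
  by rewrite sin0 subrr.
have y3 : 0 <= y ^+ 3 <= y.
  case/andP: y01 => h0 h1; rewrite exprn_ge0 //=.
  by rewrite -[leRHS]expr1 ler_wiXn2l.
split; first by lra.
by move: s3; rewrite ler_norml => /andP[h _]; lra.
Qed.

Lemma eBetaE x : 0 < x < 1 -> eBeta x = (G x * G (1 - x))%:E.
Proof. by move=> /andP[x0 x1]; rewrite /eBeta !eGammaE ?subr_gt0. Qed.

(** [G(1 + x) G(1 - x)] is even, hence stationary at 0; and it equals
    [x G(x) G(1 - x)]. This is how the poles of the two sides of the reflection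
    formula are compared without computing an integral. *)
Lemma csc_defect_cvg0 :
  G x * G (1 - x) - pi / sin (pi * x) @[x --> (0 : R)^'+] --> (0 : R).
Proof.
have p0 := @pi_gt0 R.
pose h x := G (1 + x) * G (1 - x).
have h0 : h 0 = 1.
  rewrite /h addr0 subr0; have := @eGammaE R 1 ltr01; rewrite eGamma1 => -[<-].
  by rewrite mulr1.
have dh : is_derive (0 : R) 1 h 0.
  have dp : is_derive (0 : R) 1 (fun x => 1 + x) (0 + 1) by pderive.
  have dm : is_derive (0 : R) 1 (fun x => 1 - x) (0 - 1) by pderive.
  have g1 : is_derive (1 + 0 : R) 1 G (gammaD 1 (1 + 0)).
    by apply: is_derive_Gamma_integral; rewrite addr0.
  have g2 : is_derive (1 - 0 : R) 1 G (gammaD 1 (1 - 0)).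
    by apply: is_derive_Gamma_integral; rewrite subr0.
  have H := derM (der_comp dp g1) (der_comp dm g2).
  by apply: (is_derive_eq H); rewrite addr0 subr0; ring.
have lim1 : (h x - 1) / x @[x --> (0 : R)^'+] --> (0 : R).
  apply: cvg_dnbhs_at_right.
  have := @ex_derive _ _ _ _ _ _ _ dh; rewrite /derivable => cv.
  have dE : 'D_1 h 0 = 0 by case: dh.
  rewrite /derive in dE; rewrite dE in cv.
  apply: cvg_trans cv; apply: near_eq_cvg; apply: nearW => x /=.
  by rewrite h0 addr0 /GRing.scale /= mulr1 mulrC.
have lim2 : (sin (pi * x) - pi * x) / (x * sin (pi * x)) @[x --> (0 : R)^'+] --> (0 : R).
  apply/cvgrPdist_le => e e0; near=> x.
  have x0 : 0 < x by near: x; exact: nbhs_right_gt.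
  have xe : x <= e / (2 * pi ^+ 2).
    by near: x; apply: nbhs_right_le; rewrite divr_gt0 // mulr_gt0 // exprn_gt0.
  have x1 : x <= 1 / pi by near: x; apply: nbhs_right_le; rewrite divr_gt0.
  have y0 : 0 < pi * x by rewrite mulr_gt0.
  have y01 : 0 <= pi * x <= 1.
    by rewrite ltW //= mulrC -ler_pdivlMr.
  have [s1 s2] := sin_lower_bounds y01.
  have s0 : 0 < sin (pi * x) by apply: lt_le_trans s2; rewrite divr_gt0.
  rewrite sub0r normrN normrM [X in _ * X]gtr0_norm ?invr_gt0 ?mulr_gt0 //.
  rewrite ler_pdivrMr ?mulr_gt0 //; apply: le_trans s1 _.
  apply: (@le_trans _ _ (e * (x * (pi * x / 2)))); last first.
    by rewrite ler_wpM2l ?(ltW e0) // ler_wpM2l // ltW.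
  rewrite ler_pdivlMr ?mulr_gt0 ?exprn_gt0 // in xe.
  have -> : (pi * x) ^+ 3 = x * (2 * pi ^+ 2) * (x * (pi * x / 2)) by field.
  by rewrite ler_wpM2r // mulr_ge0 ?divr_ge0 // ltW.
suff : G x * G (1 - x) - pi / sin (pi * x) @[x --> (0 : R)^'+] --> (0 + 0 : R).
  by rewrite addr0.
apply: (cvg_trans _ (cvgD lim1 lim2)).
apply: near_eq_cvg; near=> x.
have x0 : 0 < x by near: x; exact: nbhs_right_gt.
have x1 : x < 1 by near: x; exact: nbhs_right_lt.
have s0 : 0 < sin (pi * x) by apply: sin_gt0_pi; rewrite mulr_gt0 //= gtr_pMr.
rewrite fctE /h [1 + x]addrC Gamma_integralS //.
move: (G x) (G (1 - x)) (pi : R) (sin _) s0 p0 => u v p w w0 p0'.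
by field; rewrite !gt_eqF.
Unshelve. all: end_near. Qed.

Let triple_subr (a b c e s0 s1 s2 : R) : 3 * a + b = c + e ->
  3 * a - (s0 - s1 + s2) = (c - s0) - (b - s1) + (e - s2).
Proof. by move=> abce; have -> : 3 * a = c + e - b; [rewrite -abce addrK|ring]. Qed.

(** The defect between the two sides satisfies the hypotheses of Herglotz' trick. *)
Lemma Gamma_integral_reflection x : 0 < x < 1 -> G x * G (1 - x) = pi / sin (pi * x).
Proof.
have p0 := @pi_gt0 R.
have spos y : 0 < y < 1 -> 0 < sin (pi * y).
  by move=> /andP[y0 y1]; apply: sin_gt0_pi; rewrite mulr_gt0 //= gtr_pMr.
pose d x := G x * G (1 - x) - pi / sin (pi * x).
suff d0 y : 0 < y < 1 -> d y = 0 by move=> /d0/eqP; rewrite subr_eq0 => /eqP.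
apply: herglotz => {}x.
- move=> x01; have /andP[x0 x1] := x01; apply: cvgB; apply: cvgM.
  + exact: der_continuous (is_derive_Gamma_integral x0).
  + have x'0 : 0 < 1 - x by rewrite subr_gt0.
    have d1 : is_derive x 1 (fun x => 1 - x) (0 - 1) by pderive.
    exact: der_continuous (der_comp d1 (is_derive_Gamma_integral x'0)).
  + exact: cvg_cst.
  + have ds : is_derive x 1 (fun x => sin (pi * x)) (cos (pi * x) * pi) by pderive; ring.
    by apply: cvgV; [rewrite gt_eqF ?spos|exact: der_continuous ds].
- exact: csc_defect_cvg0.
- move=> /andP[x0 x1]; rewrite /d subKr mulrC; congr (_ - _ / _).
  by rewrite mulrBr mulr1 sinB sinpi cospi mul0r sub0r mulN1r opprK.
- move=> x01; have /andP[x0 x1] := x01; rewrite /d mulrBr csc_triple //.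
  have h0 : 0 < x / 3 < 1 by apply/andP; split; lra.
  have h1 : 0 < (x + 1) / 3 < 1 by apply/andP; split; lra.
  have h2 : 0 < (x + 2) / 3 < 1 by apply/andP; split; lra.
  have := eBeta_triple x01.
  rewrite (eBetaE x01) (eBetaE h0) (eBetaE h1) (eBetaE h2) => -[E].
  apply: triple_subr; exact: E.
Qed.

End GammaReflection.

(** * Families of Taylor coefficients *)

Section TaylorFamilies.
Variable R : realType.
Implicit Types (D E : nat -> R -> R) (e t : R) (n : nat).

(** [D n] plays the role of the [n]-th derivative of [D 0] divided by [n!] on
    [`]-e, e[]; with this normalisation Leibniz' rule is a plain convolution. *)
Definition taylor_family e D := forall n t, `|t| < e ->
  is_derive t 1 (D n) (n.+1%:R * D n.+1 t).

Lemma taylor_family_le e e' D : e' <= e -> taylor_family e D -> taylor_family e' D.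
Proof. by move=> le_e' TD n t /lt_le_trans/(_ le_e'); apply: TD. Qed.

Let near_ball e t : `|t| < e -> \forall s \near t, `|s| < e.
Proof.
move=> te; have e0 : 0 < e by apply: le_lt_trans te.
have : nbhs t [set s | s \in `](- e), e[].
  apply: near_in_itvoo; by rewrite in_itv /= -ltr_norml.
by apply: filterS => s /=; rewrite in_itv /= -ltr_norml.
Qed.

(** Each member of a family determines the next one as a derivative. *)
Lemma taylor_family_uniq e D E : taylor_family e D -> taylor_family e E ->
  (forall t, `|t| < e -> D 0 t = E 0 t) -> forall n t, `|t| < e -> D n t = E n t.
Proof.
move=> TD TE DE0; elim=> [//|n IHn] t te.
have n0 : n.+1%:R != 0 :> R by rewrite pnatr_eq0.
apply: (mulfI n0).
have dE : is_derive t 1 (E n) (n.+1%:R * D n.+1 t).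
  apply: (near_eq_is_derive _ (TD n t te)).
  by near=> s; apply: IHn; near: s; exact: near_ball.
by have := TE n t te; case: dE => _ <- [_ <-].
Unshelve. all: end_near. Qed.

Lemma taylor_familyM e D E : taylor_family e D -> taylor_family e E ->
  taylor_family e (fun n t => \sum_(i < n.+1) D i t * E (n - i)%N t).
Proof.
move=> TD TE n t te.
pose dterm i := (i.+1%:R * D i.+1 t) * E (n - i)%N t +
  D i t * ((n - i).+1%:R * E (n - i).+1 t).
have dk i : is_derive t 1 (fun s => D i s * E (n - i)%N s) (dterm i).
  by apply: derM; [exact: TD|exact: TE].
apply: (is_derive_eq (der_sum _ dk)); rewrite /dterm big_split /=.
rewrite [X in X + _](_ : _ = \sum_(i < n.+2) i%:R * (D i t * E (n.+1 - i)%N t)).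
  rewrite [X in _ + X](_ : _ = \sum_(i < n.+2) (n.+1 - i)%:R * (D i t * E (n.+1 - i)%N t)).
    rewrite -big_split mulr_sumr /=; apply: eq_bigr => i _.
    by rewrite -mulrDl -natrD subnKC // -ltnS.
  rewrite [RHS]big_ord_recr /= subnn mulr0n mul0r addr0; apply: eq_bigr => i _.
  by rewrite subSn 1?mulrCA // -ltnS.
rewrite [RHS]big_ord_recl /= mulr0n mul0r add0r; apply: eq_bigr => i _.
by rewrite /bump /= add1n subSS mulrA.
Qed.

Lemma taylor_familyN e D : taylor_family e D ->
  taylor_family e (fun n t => (- 1) ^+ n * D n (- t)).
Proof.
move=> TD n t te.
have dn : is_derive t 1 (fun s => - s) (- 1) by apply: derN (derI t).
have dD : is_derive (- t) 1 (D n) (n.+1%:R * D n.+1 (- t)).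
  by apply: TD; rewrite normrN.
apply: (is_derive_eq (derM (derC t ((- 1) ^+ n)) (der_comp dn dD))).
by rewrite exprS; ring.
Qed.

Lemma taylor_family_poly e (p : {poly R}) :
  taylor_family e (fun n t => p^`N(n).[t]).
Proof.
move=> n t _; apply: (is_derive_eq (is_derive_poly _ t)).
rewrite -hornerZ; congr horner; apply/polyP => i.
rewrite coefZ coef_deriv !coef_nderivn -mulrnA.
rewrite mulr_natl -mulrnA addnS addSn; congr (_ *+ _).
by rewrite mulnC [RHS]mulnC mul_bin_left -addnS addKn.
Qed.

Lemma taylor_family_cos e :
  taylor_family e (fun n t => pi ^+ n / n`!%:R * cos (pi * t + n%:R * (pi / 2))).
Proof.
move=> n t _; have d1 : is_derive t 1 (fun s => pi * s + n%:R * (pi / 2)) pi.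
  by pderive; ring.
apply: (is_derive_eq (derM (derC t (pi ^+ n / n`!%:R)) (dercos d1))).
rewrite mul0r add0r factS natrM invfM exprS.
have -> : n.+1%:R * (pi / 2) = n%:R * (pi / 2) + pi / 2 :> R.
  by rewrite -natr1; ring.
rewrite addrA cosDpihalf.
have n0 : n.+1%:R != 0 :> R by rewrite pnatr_eq0.
move: (sin _) (n.+1%:R : R) (n`!%:R^-1 : R) (pi ^+ n : R) n0 => v a f u a0.
by field.
Qed.

Lemma taylor_family_sin e :
  taylor_family e (fun n t => pi ^+ n / n`!%:R * sin (pi * t + n%:R * (pi / 2))).
Proof.
move=> n t _; have d1 : is_derive t 1 (fun s => pi * s + n%:R * (pi / 2)) pi.
  by pderive; ring.
apply: (is_derive_eq (derM (derC t (pi ^+ n / n`!%:R)) (dersin d1))).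
rewrite mul0r add0r factS natrM invfM exprS.
have -> : n.+1%:R * (pi / 2) = n%:R * (pi / 2) + pi / 2 :> R.
  by rewrite -natr1; ring.
rewrite addrA sinDpihalf.
have n0 : n.+1%:R != 0 :> R by rewrite pnatr_eq0.
move: (cos _) (n.+1%:R : R) (n`!%:R^-1 : R) (pi ^+ n : R) n0 => v a f u a0.
by field.
Qed.

Lemma taylor_family_inv (a : R) : a != 0 ->
  taylor_family `|a| (fun n t => (- 1) ^+ n * (a + t)^-1 ^+ n.+1).
Proof.
move=> a0 n t ta.
have at0 : a + t != 0.
  by rewrite addrC addr_eq0; apply: contraTneq ta => ->; rewrite normrN ltxx.
have d1 : is_derive t 1 (fun s => a + s) 1 by pderive; ring.
apply: (is_derive_eq (derM (derC t ((- 1) ^+ n)) (derX n.+1 (derV at0 d1)))).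
by rewrite exprVn -!exprVn !exprS /=; ring.
Qed.

Lemma taylor_family_Gamma_integral (q : R) : 0 < q ->
  taylor_family q (fun n t => gammaD n (q + t) / n`!%:R).
Proof.
move=> q0 n t tq.
have d1 : is_derive t 1 (fun s => q + s) 1 by pderive; ring.
have d2 : is_derive (q + t) 1 (gammaD n) (gammaD n.+1 (q + t)).
  apply: is_derive_gammaD; move: tq; rewrite ltr_norml => /andP[qt _].
  by rewrite -[X in X < _](subrr q) ltrD2l.
apply: (is_derive_eq (derM (der_comp d1 d2) (derC t n`!%:R^-1))).
rewrite mulr1 mulr0 addr0 factS natrM invfM.
have n0 : n.+1%:R != 0 :> R by rewrite pnatr_eq0.
by rewrite mulrCA mulVKf.
Qed.

(** The link with iterated derivatives: these only see a neighbourhood of the point. *)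
Lemma derive1n_taylor_family e D (f : R -> R) (q : R) n t : taylor_family e D ->
  (forall t, `|t| < e -> f (q + t) = D 0 t) -> `|t| < e ->
  derive1n n f (q + t) = n`!%:R * D n t.
Proof.
move=> TD fD; elim: n t => [|n IHn] t te; first by rewrite derive1n0 fact0 mul1r fD.
rewrite derive1nS derive1E.
have near_q : \forall s \near q + t, `|s - q| < e.
  have : nbhs (q + t) [set s | s \in `](q - e), (q + e)[].
    apply: near_in_itvoo; rewrite in_itv /= !ltrD2l.
    by rewrite -ltr_norml.
  apply: filterS => s /=; rewrite in_itv /= ltr_norml => /andP[h1 h2].
  by rewrite ltrBrDl h1 ltrBlDl.
have d1 : is_derive (q + t) 1 (fun s => s - q) 1 by pderive; ring.
have d2 : is_derive (q + t - q) 1 (D n) (n.+1%:R * D n.+1 t).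
  by rewrite addrC addKr; exact: TD.
have d3 := derM (derC (q + t) n`!%:R) (der_comp d1 d2).
suff d4 : is_derive (q + t) 1 (derive1n n f) (n`!%:R * (n.+1%:R * D n.+1 t)).
  by case: d4 => _ ->; rewrite mulrA -natrM mulnC -factS.
have := near_eq_is_derive _ d3; rewrite mul0r add0r mulr1; apply.
near=> s; have se : `|s - q| < e by near: s.
by rewrite -(IHn (s - q) se) [q + _]addrC subrK.
Unshelve. all: end_near. Qed.

End TaylorFamilies.

(** * The Gamma function around half-integers *)

Section GammaNearHalfIntegers.
Variable R : realType.
Implicit Types (q t x : R) (m k n : nat).
Local Notation G := (@Gamma_integral R).
Local Notation Gamma := (@Gamma R).
Local Opaque Gamma_integral.

Lemma half_integer_cases q : half_integer q -> ~ nonpositive_integer q ->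
  [\/ exists m : nat, q = m.+1%:R, exists m : nat, q = 2^-1 + m%:R |
      exists m : nat, q = 2^-1 - m.+1%:R].
Proof.
move=> [z ->] nonpos.
have zE := divz_eq z 2; set w := (z %/ 2)%Z in zE.
have [b bE] : exists b : bool, (z %% 2)%Z = b%:Z.
  have := modz_ge0 z (isT : 2 != 0 :> int); have := ltz_pmod z (isT : 0 < 2 :> int).
  by case: (z %% 2)%Z => [[|[|]]|] // _ _; [exists false|exists true].
have qE : z%:~R / 2 = w%:~R + b%:R / 2 :> R.
  by rewrite zE bE intrD intrM; field.
case: b bE qE => bE qE; rewrite qE.
  case: w {zE qE} => m.
    by apply: Or32; exists m; rewrite addrC mul1r.
  by apply: Or33; exists m; rewrite NegzE mul1r mulrNz addrC.
rewrite mul0r addr0 in qE *.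
case: w {zE} qE => [[|m]|m] qE.
- by case: nonpos; exists 0%N; rewrite qE oppr0.
- by apply: Or31; exists m.
- by case: nonpos; exists m.+1; rewrite qE NegzE mulrNz.
Qed.

Lemma Gamma_pos x : 0 < x -> Gamma x = G x.
Proof.
move=> x0; rewrite /Defs.Gamma ltNge (ltW x0) /= addr0 big_ord0 divr1 //.
Qed.

Lemma Gamma_shift m x : 0 < x + m.+1%:R < 1 ->
  Gamma x = G (x + m.+1%:R) / \prod_(i < m.+1) (x + i%:R).
Proof.
move=> /andP[x0 x1]; rewrite /Defs.Gamma.
have m0 : (0 : R) <= m%:R by rewrite ler0n.
have -> : x < 0 by move: x1; rewrite -natr1; lra.
have -> : Num.floor x = - (m.+1%:Z).
  apply: Num.Theory.floor_def; rewrite intrD !mulrNz.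
  by apply/andP; split; [lra|rewrite -ltrBlDr; lra].
by [].
Qed.

Lemma Gamma_integral_rising m x : 0 < x ->
  G (x + m%:R) = G x * \prod_(i < m) (x + i%:R).
Proof.
move=> x0; elim: m => [|m IHm]; first by rewrite addr0 big_ord0 mulr1.
rewrite -natr1 addrA Gamma_integralS ?IHm ?big_ord_recr /=; last first.
  by rewrite ltr_wpDr.
by rewrite mulrC mulrA.
Qed.

(** Division by the linear factors one at a time; the distance [e] keeps their zeros out. *)
Lemma taylor_family_prod_inv q m e D : taylor_family e D ->
  (forall i : nat, e <= `|q + i%:R|) -> 0 < e ->
  exists E, taylor_family e E /\
    forall t, `|t| < e -> E 0 t = D 0 t / \prod_(i < m) (q + t + i%:R).
Proof.
move=> TD far e0; elim: m => [|m [E [TE E0]]].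
  by exists D; split=> // t _; rewrite big_ord0 divr1.
have qm0 : q + m%:R != 0 by rewrite -normr_gt0 (lt_le_trans e0).
exists (fun n t => \sum_(i < n.+1) E i t *
   ((- 1) ^+ (n - i) * (q + m%:R + t)^-1 ^+ (n - i).+1)); split.
  exact: taylor_familyM TE (taylor_family_le (far m) (taylor_family_inv qm0)).
move=> t te; rewrite big_ord1 E0 // subnn expr0 mul1r expr1 big_ord_recr /=.
by rewrite invfM mulrA [q + t + _]addrAC.
Qed.

Lemma half_far (F : realFieldType) (w : int) : 2^-1 <= `|2^-1 + w%:~R : F|.
Proof.
case: w => k; first by rewrite ger0_norm ?addr_ge0 // lerDl ler0n.
rewrite NegzE mulrNz -[k.+1%:~R]/(k.+1%:R : F) -[k.+1%:R]natr1.
by have k0 := ler0n F k; rewrite ler0_norm; lra.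
Qed.

Lemma Gamma_taylor_family q : half_integer q -> ~ nonpositive_integer q ->
  exists e D, [/\ 0 < e, taylor_family e D & forall t, `|t| < e -> Gamma (q + t) = D 0 t].
Proof.
have posE p : 0 < p -> exists e D, [/\ 0 < e, taylor_family e D &
    forall t, `|t| < e -> Gamma (p + t) = D 0 t].
  move=> p0; exists p, (fun n t => gammaD n (p + t) / n`!%:R); split => //.
    exact: taylor_family_Gamma_integral.
  move=> t tp; rewrite gammaD0 fact0 divr1 Gamma_pos //.
  by move: tp; rewrite ltr_norml => /andP[]; lra.
move=> hq nq; case: (half_integer_cases hq nq) => -[m ->].
- by apply: posE; rewrite ltr0n.
- by apply: posE; rewrite ltr_wpDr // invr_gt0.
have h0 : 0 < 2^-1 :> R by rewrite invr_gt0.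
have far (i : nat) : 2^-1 <= `|2^-1 - m.+1%:R + i%:R : R|.
  have := half_far R (i%:Z - m.+1%:Z); rewrite intrD mulrNz.
  by congr (_ <= `| _ |); ring.
have [E [TE E0]] := taylor_family_prod_inv m.+1 (taylor_family_Gamma_integral h0) far h0.
exists 2^-1, E; split=> // t te.
have xE : 2^-1 - m.+1%:R + t + m.+1%:R = 2^-1 + t :> R by ring.
rewrite (@Gamma_shift m) xE; last by move: te; rewrite ltr_norml => /andP[]; lra.
by rewrite E0 // gammaD0 fact0 divr1.
Qed.

(** The factors that the functional equation produces at [a + t] and at [a - t], together;
    they form an even polynomial in [t]. *)
Definition even_rising (a : rat) m : {poly rat} :=
  \prod_(i < m) (((a + i%:R)%:P + 'X) * ((a + i%:R)%:P - 'X)).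

Lemma even_rising_horner (a : rat) m t :
  (map_poly ratr (even_rising a m)).[t] =
  (\prod_(i < m) (ratr a + t + i%:R)) * (\prod_(i < m) (ratr a - t + i%:R)).
Proof.
rewrite -big_split /= rmorph_prod horner_prod; apply: eq_bigr => i _.
rewrite rmorphM rmorphD rmorphB /= map_polyC map_polyX /= rmorphD rmorph_nat.
by rewrite !hornerE; congr (_ * _); rewrite addrAC.
Qed.

Lemma even_rising_coef0 (a : rat) m : (forall i : nat, a + i%:R != 0) ->
  (even_rising a m)`_0 != 0.
Proof.
move=> a0; rewrite -horner_coef0 horner_prod; apply/prodf_neq0 => i _.
by rewrite !hornerE mulf_neq0.
Qed.

(** The reflection formula around a half-integer [q], up to polynomial factors
    in the variable [t] that do not vanish at 0. *)
Lemma Gamma_product_relation q : half_integer q -> ~ nonpositive_integer q ->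
  exists (A B : {poly rat}) (b : bool), [/\ A`_0 != 0, B`_0 != 0 &
   forall t, `|t| < 2^-1 -> Gamma (q + t) * Gamma (q - t) * (map_poly ratr A).[t] *
     (if b then cos (pi * t) else sin (pi * t)) =
     pi * (if b then 1 else t) * (map_poly ratr B).[t] ].
Proof.
have h0 : 0 < 2^-1 :> R by rewrite invr_gt0.
have hratr : ratr 2^-1 = 2^-1 :> R by rewrite fmorphV rmorph_nat.
have half_reflection t : `|t| < 2^-1 -> G (2^-1 + t) * G (2^-1 - t) * cos (pi * t) = pi.
  move=> te; have t12 : 0 < 2^-1 + t < 1.
    by move: te; rewrite ltr_norml => /andP[h1 h2]; apply/andP; split; lra.
  have := Gamma_integral_reflection t12.
  have -> : 1 - (2^-1 + t) = 2^-1 - t :> R by field.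
  have -> : pi * (2^-1 + t) = pi * t + pi / 2 :> R by ring.
  rewrite sinDpihalf => ->; rewrite divfK // gt_eqF //; apply: cos_gt0_pihalf.
  have p0 := @pi_gt0 R; move: te; rewrite ltr_norml => /andP[h1 h2].
  by apply/andP; split; rewrite -1?mulrN ltr_pM2l.
have one_reflection t : `|t| < 2^-1 -> G (1 + t) * G (1 - t) * sin (pi * t) = pi * t.
  have pos s : 0 < s < 1 -> G (1 + s) * G (1 - s) * sin (pi * s) = pi * s.
    move=> s01; have /andP[s0 s1] := s01.
    rewrite [1 + s]addrC Gamma_integralS // -!mulrA [G s * _]mulrA.
    have sin_neq0 : sin (pi * s) != 0.
      rewrite gt_eqF //; apply: sin_gt0_pi.
      by rewrite mulr_gt0 ?pi_gt0 //= gtr_pMr // pi_gt0.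
    by rewrite Gamma_integral_reflection // divfK // mulrC.
  rewrite ltr_norml => /andP[h1 h2]; have [t0|t0|->] := ltgtP t 0.
  - have nt01 : 0 < - t < 1 by apply/andP; split; lra.
    have := pos _ nt01; rewrite opprK [pi * - t]mulrN sinN mulrN => /oppr_inj H.
    by rewrite -[RHS]H (mulrC (G (1 + t))).
  - by apply: pos; apply/andP; split; lra.
  - by rewrite mulr0 sin0 mulr0.
have pm t : `|t| < 2^-1 -> [/\ 0 < 2^-1 + t < 1, 0 < 2^-1 - t < 1, 0 < 1 + t & 0 < 1 - t].
  rewrite ltr_norml => /andP[h1 h2]; split; rewrite -?lt_def.
  - by apply/andP; split; lra.
  - by apply/andP; split; lra.
  - lra.
  - lra.
have GammaE m x : 0 < x -> Gamma (x + m%:R) = G x * \prod_(i < m) (x + i%:R).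
  by move=> x0; rewrite -(Gamma_integral_rising m x0) Gamma_pos // ltr_wpDr.
have pos_half (i : nat) : (2^-1 + i%:R : rat) != 0 by rewrite gt_eqF // ltr_wpDr.
move=> hq nq; case: (half_integer_cases hq nq) => -[m ->].
- exists 1, (even_rising 1 m), false; split.
  + by rewrite coef1.
  + by apply: even_rising_coef0 => i; rewrite gt_eqF // ltr_wpDr.
  move=> t te; have [_ _ p1 p2] := pm t te.
  have e1 : m.+1%:R + t = 1 + t + m%:R :> R by rewrite -natr1; ring.
  have e2 : m.+1%:R - t = 1 - t + m%:R :> R by rewrite -natr1; ring.
  rewrite e1 e2 (GammaE m _ p1) (GammaE m _ p2).
  rewrite rmorph1 hornerC mulr1 even_rising_horner rmorph1.
  have := one_reflection t te.
  move: (G _) (G _) (\prod_(i < m) _) (\prod_(i < m) _) (sin _) => a b c d e <-.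
  by ring.
- exists 1, (even_rising 2^-1 m), true; split.
  + by rewrite coef1.
  + exact: even_rising_coef0.
  move=> t te; have [/andP[p1 _] /andP[p2 _] _ _] := pm t te.
  have e1 : 2^-1 + m%:R + t = 2^-1 + t + m%:R :> R by ring.
  have e2 : 2^-1 + m%:R - t = 2^-1 - t + m%:R :> R by ring.
  rewrite e1 e2 (GammaE m _ p1) (GammaE m _ p2).
  rewrite rmorph1 hornerC !mulr1 even_rising_horner hratr.
  have := half_reflection t te.
  move: (G _) (G _) (\prod_(i < m) _) (\prod_(i < m) _) (cos _) => a b c d e <-.
  by ring.
- exists (even_rising (2^-1 - m.+1%:R) m.+1), 1, true; split.
  + apply: even_rising_coef0 => i.
    rewrite -normr_gt0 (@lt_le_trans _ _ (2^-1 : rat)) //.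
    have := half_far rat (i%:Z - m.+1%:Z); rewrite intrD mulrNz.
    by congr (_ <= `| _ |); ring.
  + by rewrite coef1.
  move=> t te; have [p1 p2 _ _] := pm t te.
  have e1 : 2^-1 - m.+1%:R + t + m.+1%:R = 2^-1 + t :> R by ring.
  have e2 : 2^-1 - m.+1%:R - t + m.+1%:R = 2^-1 - t :> R by ring.
  have ratrE : ratr (2^-1 - m.+1%:R) = 2^-1 - m.+1%:R :> R.
    by rewrite rmorphB /= hratr rmorph_nat.
  rewrite !(@Gamma_shift m) ?e1 ?e2 //.
  rewrite rmorph1 hornerC !mulr1 even_rising_horner ratrE.
  rewrite -[RHS](half_reflection t te).
  have prod_neq0 s : `|s| < 2^-1 -> \prod_(i < m.+1) (2^-1 - m.+1%:R + s + i%:R) != 0 :> R.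
    move=> s2; apply/prodf_neq0 => i _; rewrite addrAC addr_eq0.
    apply: contraTneq s2 => sE; rewrite -normrN -sE -leNgt.
    have := half_far R (i%:Z - m.+1%:Z); rewrite intrD mulrNz.
    by congr (_ <= `| _ |); ring.
  have n1 := prod_neq0 t te; have n2 := prod_neq0 (- t); rewrite normrN in n2.
  move: (G _) (G _) (\prod_(i < m.+1) _) (\prod_(i < m.+1) _) (cos _) n1 (n2 te).
  by move=> a b c d e c0 d0; field; rewrite c0 d0.
Qed.

End GammaNearHalfIntegers.

(** * Cauchy products, the secant and the cosecant *)

Section CauchyProduct.
Variable A : comNzRingType.
Implicit Types f g h : nat -> A.

(** Cauchy product of the coefficient sequences of two formal power series. *)
Definition cauchy_mul f g n : A := \sum_(j < n.+1) f j * g (n - j)%N.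

Definition cauchy_one n : A := (n == 0%N)%:R.

(** Cauchy products are coefficients of products of truncations; this transfers the ring laws
    from polynomials. *)
Lemma cauchy_mul_poly N n f g : (n < N)%N ->
  cauchy_mul f g n = ((\poly_(i < N) f i) * (\poly_(i < N) g i))`_n.
Proof.
move=> nN; rewrite coefM; apply: eq_bigr => j _.
rewrite !coef_poly (leq_ltn_trans (leq_subr _ _) nN).
by rewrite (leq_ltn_trans _ nN) // -ltnS ltn_ord.
Qed.

Lemma eq_cauchy_mul f f' g g' n : (forall j, (j <= n)%N -> f j = f' j) ->
  (forall j, (j <= n)%N -> g j = g' j) -> cauchy_mul f g n = cauchy_mul f' g' n.
Proof.
move=> ff' gg'; apply: eq_bigr => j _; rewrite ff' -1?ltnS //.
by rewrite gg' // leq_subr.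
Qed.

Lemma cauchy_mulC f g n : cauchy_mul f g n = cauchy_mul g f n.
Proof. by rewrite !(@cauchy_mul_poly n.+1) // mulrC. Qed.

Lemma cauchy_mulA f g h n : cauchy_mul f (cauchy_mul g h) n = cauchy_mul (cauchy_mul f g) h n.
Proof.
pose P f := \poly_(i < n.+1) f i.
have coefP u j : (j < n.+1)%N -> (P u)`_j = u j by rewrite coef_poly => ->.
transitivity ((P f * (P g * P h))`_n).
  rewrite coefM; apply: eq_bigr => j _; rewrite coefP //.
  by rewrite (@cauchy_mul_poly n.+1) // ltnS leq_subr.
rewrite mulrA coefM; apply: eq_bigr => j _; rewrite (@cauchy_mul_poly n.+1) //.
by rewrite coefP // ltnS leq_subr.
Qed.

Lemma cauchy_mulr1 f n : cauchy_mul f cauchy_one n = f n.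
Proof.
rewrite /cauchy_mul big_ord_recr /= subnn /cauchy_one mulr1 big1 ?add0r // => j _.
by rewrite subn_eq0 leqNgt ltn_ord mulr0.
Qed.

Lemma cauchy_mulZl c f g n : cauchy_mul (fun i => c * f i) g n = c * cauchy_mul f g n.
Proof. by rewrite /cauchy_mul mulr_sumr; apply: eq_bigr => j _; rewrite mulrA. Qed.

Lemma cauchy_mul_scale x f g n :
  cauchy_mul (fun i => f i * x ^+ i) (fun i => g i * x ^+ i) n = cauchy_mul f g n * x ^+ n.
Proof.
rewrite /cauchy_mul mulr_suml; apply: eq_bigr => j _.
by rewrite mulrACA -exprD subnKC // -ltnS.
Qed.

Lemma cauchy_mul_shift c f g h n : g 0%N = 0 -> (forall j, g j.+1 = c * h j) ->
  cauchy_mul f g n.+1 = c * cauchy_mul f h n.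
Proof.
move=> g0 gS; rewrite cauchy_mulC [in RHS]cauchy_mulC /cauchy_mul mulr_sumr.
rewrite big_ord_recl g0 mul0r add0r; apply: eq_bigr => j _.
by rewrite /= /bump add1n gS subSS mulrA.
Qed.

Lemma cauchy_mul_cancel f a g h : (forall n, cauchy_mul h a n = cauchy_one n) ->
  (forall n, cauchy_mul f a n = g n) -> forall n, f n = cauchy_mul g h n.
Proof.
move=> ha fa n; rewrite -[LHS]cauchy_mulr1.
rewrite (eq_cauchy_mul (f' := f) (g' := cauchy_mul a h)) //; last first.
  by move=> j _; rewrite cauchy_mulC ha.
by rewrite cauchy_mulA; apply: eq_cauchy_mul.
Qed.

Lemma cauchy_inv_unique a f g : (forall n, cauchy_mul f a n = cauchy_one n) ->
  (forall n, cauchy_mul g a n = cauchy_one n) -> forall n, f n = g n.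
Proof.
move=> fa ga n; rewrite (cauchy_mul_cancel ga fa) cauchy_mulC.
exact: cauchy_mulr1.
Qed.

End CauchyProduct.

Lemma rmorph_cauchy_mul (A B : comNzRingType) (r : {rmorphism A -> B}) (f g : nat -> A) n :
  r (cauchy_mul f g n) = cauchy_mul (r \o f) (r \o g) n.
Proof. by rewrite rmorph_sum; apply: eq_bigr => j _; rewrite rmorphM. Qed.

Section ConvolutionInverse.
Variables (F : fieldType) (a : nat -> F).
Hypothesis a0 : a 0%N != 0.

(** Each coefficient of the inverse depends on all the previous ones, so they are built as
    a growing list. *)
Fixpoint cauchy_inv_seq n : seq F :=
  if n isn't n'.+1 then [:: (a 0%N)^-1] else
  let s := cauchy_inv_seq n' in
  rcons s (- (a 0%N)^-1 * \sum_(j < n'.+1) s`_j * a (n'.+1 - j)%N).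

Lemma size_conv_inv_seq n : size (cauchy_inv_seq n) = n.+1.
Proof. by elim: n => //= n IHn; rewrite size_rcons IHn. Qed.

Lemma cauchy_inv_seq_coherent n m : (n <= m)%N ->
  (cauchy_inv_seq m)`_n = (cauchy_inv_seq n)`_n.
Proof.
elim: m => [|m IHm]; first by case: n.
rewrite leq_eqVlt => /orP[/eqP-> //|nm].
by rewrite /= nth_rcons size_conv_inv_seq nm IHm.
Qed.

Lemma cauchy_inv_exists : exists f, forall n, cauchy_mul f a n = cauchy_one F n.
Proof.
exists (fun n => (cauchy_inv_seq n)`_n) => -[|n].
  by rewrite /cauchy_mul big_ord1 /= mulVf.
rewrite /cauchy_mul big_ord_recr subnn /= nth_rcons size_conv_inv_seq ltnn eqxx.
rewrite mulrAC mulNr mulVf // mulN1r /cauchy_one /=; apply/eqP; rewrite subr_eq0; apply/eqP.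
by apply: eq_bigr => j _; rewrite /= [in RHS]cauchy_inv_seq_coherent // -ltnS.
Qed.

End ConvolutionInverse.

Lemma big_ord_parity (V : nmodType) k (f : nat -> V) :
  \sum_(i < k.*2) f i = \sum_(j < k) (f j.*2 + f j.*2.+1).
Proof.
elim: k => [|k IHk]; first by rewrite !big_ord0.
by rewrite doubleS !big_ord_recr /= IHk addrA.
Qed.

(** Pascal's rule turns the odd entries of a row into all entries of the previous one. *)
Lemma sum_odd_bin k : (\sum_(j < k.+1) 'C(k.*2.+1, j.*2.+1) = 4 ^ k)%N.
Proof.
rewrite (eq_bigr (fun j : 'I_k.+1 => 'C(k.*2, j.*2) + 'C(k.*2, j.*2.+1))%N); last first.
  by move=> j _; rewrite binS addnC.
have := big_ord_parity k.+1 (fun i => 'C(k.*2, i)); rewrite /= => <-.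
rewrite doubleS big_ord_recr /= bin_small // addr0.
have := Pascal 1 1 k.*2; rewrite addn1 -mul2n expnM => ->.
by rewrite mul2n; apply: eq_bigr => i _; rewrite !exp1n !muln1.
Qed.

Section Positivity.
Variable F : realFieldType.
Implicit Types E Y : nat -> F.

Definition cos_coef j : F := (- 1) ^+ j / (j.*2)`!%:R.
Definition sinc_coef j : F := (- 1) ^+ j / (j.*2.+1)`!%:R.

Lemma factorial_dominates_geometric i : 4 ^+ i.+1 / (i.+2.*2)`!%:R <= 6^-1 * 4^-1 ^+ i :> F.
Proof.
elim: i => [|i IHi]; first by rewrite expr1 expr0 mulr1 -[(_)`!]/24%N; lra.
rewrite exprS [in leRHS]exprS doubleS.
have m4 : (4 <= i.+2.*2)%N by [].
move: (i.+2.*2) m4 IHi => m m4; rewrite !factS !natrM !invfM.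
set X := 4 ^+ i.+1; set y := m`!%:R^-1 => IHi.
rewrite [leLHS](_ : _ = (4 * m.+2%:R^-1 * m.+1%:R^-1) * (X * y)); last by ring.
rewrite [leRHS]mulrCA ler_pM ?mulr_ge0 ?exprn_ge0 ?invr_ge0 ?ler0n //.
have m2 : 4 <= m.+2%:R :> F by rewrite ler_nat ?leqW.
have m1 : 4 <= m.+1%:R :> F by rewrite ler_nat ?leqW.
have m20 : 0 < m.+2%:R :> F by rewrite ltr0n.
have m10 : 0 < m.+1%:R :> F by rewrite ltr0n.
by rewrite ler_pdivrMr // ler_pdivrMr //; nra.
Qed.

(** The coefficients [E] of the secant: each is at least a quarter of its predecessor,
    because in the recurrence [E_(k+1) = E_k / 2! - E_(k-1) / 4! + ...] the terms beyond
    the first are dominated by a geometric series. *)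
Lemma sec_coef_gt0 E : (forall k, cauchy_mul E cos_coef k = cauchy_one F k) -> forall k, 0 < E k.
Proof.
move=> EC; have E0 : E 0%N = 1.
  by have := EC 0%N; rewrite /cauchy_mul big_ord1 /cos_coef /= expr0 divr1 mulr1.
have geometric k : \sum_(i < k) 4^-1 ^+ i = 4 / 3 * (1 - 4^-1 ^+ k) :> F.
  elim: k => [|k IHk]; first by rewrite big_ord0 expr0 subrr mulr0.
  by rewrite big_ord_recr /= IHk exprS; field.
have rec k : 0 < E k -> (forall i, (i <= k)%N -> 0 < E i) ->
    (forall i, (i <= k)%N -> E (k - i)%N <= 4 ^+ i * E k) -> 4^-1 * E k <= E k.+1.
  move=> Ek0 Epos Ek; have := EC k.+1; rewrite cauchy_mulC /cauchy_mul /cauchy_one !big_ord_recl /=.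
  rewrite /cos_coef /= expr0 divr1 mul1r subn0 /bump /= expr1 subn1 /=.
  (* 1/2 - 2/9 >= 1/4, where 2/9 is the sum of the geometric series of ratio 1/4 from 1/6 *)
  set T := \sum_(i < k) _; suff : T <= 2 / 9 * E k by rewrite -[2`!]/2%N; lra.
  apply: (@le_trans _ _ (\sum_(i < k) 6^-1 * 4^-1 ^+ i * E k)); last first.
    rewrite -mulr_suml -mulr_sumr geometric ler_pM2r //.
    have : 0 <= 4^-1 ^+ k :> F by rewrite exprn_ge0 ?invr_ge0.
    by set z := _ ^+ k; lra.
  apply: ler_sum => i _; rewrite !add1n subSS.
  apply: le_trans (ler_wpM2r (ltW Ek0) (factorial_dominates_geometric i)).
  rewrite [4 ^+ _ / _]mulrC -[leRHS]mulrA.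
  have y0 : 0 < (i.+2.*2)`!%:R^-1 :> F by rewrite invr_gt0 ltr0n fact_gt0.
  have Ei0 : 0 < E (k - i.+1)%N by rewrite Epos // leq_subr.
  apply: (@le_trans _ _ ((i.+2.*2)`!%:R^-1 * E (k - i.+1)%N)).
    rewrite ler_pM2r // -[leRHS]mul1r ler_pM2r //.
    by rewrite -signr_odd; case: odd; rewrite ?expr1 // (le_trans (lerN10 _)).
  by rewrite ler_pM2l // Ek.
suff H k : (forall i, (i <= k)%N -> 0 < E i) /\
    (forall i, (i <= k)%N -> E (k - i)%N <= 4 ^+ i * E k).
  by move=> k; apply: (H k).1.
elim: k => [|k [Epos Ek]].
  by split=> -[|//] _; rewrite /= ?E0 ?expr0 ?mul1r.
have Ek0 := Epos k (leqnn k); have Ek1 := rec k Ek0 Epos Ek.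
have Ek10 : 0 < E k.+1 by apply: lt_le_trans Ek1; rewrite mulr_gt0 ?invr_gt0.
split=> -[|i] ik.
- exact: Epos.
- by move: ik; rewrite leq_eqVlt => /orP[/eqP->//|]; rewrite ltnS; exact: Epos.
- by rewrite expr0 mul1r subn0.
rewrite subSS (le_trans (Ek i ik)) // exprSr -mulrA ler_pM2l ?exprn_gt0 //.
by move: Ek1; lra.
Qed.

(** With [tau] and [sigma] the coefficients of [cos t] and [sin t / t], the identity
    [sin (2 t) / (2 t) = (sin t / t) * cos t] inverts to
    [(4 ^ k - 1) * Y_k = \sum_(j < k) Y_j * E_(k - j)], where [E] is the secant. *)
Lemma sinc_inv_coef_gt0 Y : (forall k, cauchy_mul Y sinc_coef k = cauchy_one F k) ->
  forall k, 0 < Y k.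
Proof.
move=> YS; have Y0 : Y 0%N = 1.
  by have := YS 0%N; rewrite /cauchy_mul big_ord1 /sinc_coef /= expr0 divr1 mulr1.
have C0 : cos_coef 0 != 0 by rewrite /cos_coef expr0 mul1r invr_eq0 pnatr_eq0.
have [E EC] := cauchy_inv_exists C0; have Epos := sec_coef_gt0 EC.
have double_angle k : cauchy_mul sinc_coef cos_coef k = sinc_coef k * 4 ^+ k.
  transitivity (\sum_(j < k.+1) (- 1) ^+ k / (k.*2.+1)`!%:R * 'C(k.*2.+1, j.*2.+1)%:R : F).
    apply: eq_bigr => j _; have jk : (j <= k)%N by rewrite -ltnS.
    rewrite /sinc_coef /cos_coef mulrACA -exprD subnKC // -mulrA; congr (_ * _).
    have jk2 : (j.*2.+1 <= k.*2.+1)%N by rewrite ltnS leq_double.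
    rewrite -(bin_fact jk2) subSS -doubleB.
    have := fact_gt0 (k - j).*2; have := fact_gt0 j.*2.+1; move: jk2; rewrite -bin_gt0.
    move: (j.*2.+1)`! ((k - j).*2)`! 'C(_, _) => a b c c0 a0 b0.
    by rewrite !natrM; field; rewrite !pnatr_eq0 -!lt0n ?a0 ?b0 ?c0.
  by rewrite -mulr_sumr -natr_sum sum_odd_bin natrX.
have Y4 k : Y k * 4 ^+ k = cauchy_mul Y E k.
  apply: (@cauchy_inv_unique _ (fun k => sinc_coef k * 4 ^+ k)
    (fun k => Y k * 4 ^+ k) (cauchy_mul Y E)) => n.
    by rewrite cauchy_mul_scale YS /cauchy_one; case: n => [|n]; rewrite ?mul0r // mul1r.
  rewrite (eq_cauchy_mul (f' := cauchy_mul E Y) (g' := cauchy_mul sinc_coef cos_coef)) //; last first.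
    by move=> j _; rewrite cauchy_mulC.
  rewrite cauchy_mulA (eq_cauchy_mul (f' := E) (g' := cos_coef)) // => j _.
  rewrite -cauchy_mulA (eq_cauchy_mul (f' := E) (g' := cauchy_one F)) //.
  exact: cauchy_mulr1.
elim/ltn_ind => -[|k] IHk; first by rewrite Y0.
have := Y4 k.+1; rewrite /cauchy_mul big_ord_recr /= subnn.
have E0 : E 0%N = 1.
  by have := EC 0%N; rewrite /cauchy_mul big_ord1 /cos_coef /= expr0 divr1 mulr1.
rewrite E0 mulr1 => YE; have : 0 < Y k.+1 * (4 ^+ k.+1 - 1).
  rewrite mulrBr mulr1 YE addrK big_ord_recl /=.
  rewrite ltr_wpDr ?mulr_gt0 ?Y0 // sumr_ge0 // => j _.
  by rewrite mulr_ge0 ?ltW // IHk // /bump /= add1n ltnS.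
by rewrite pmulr_lgt0 // subr_gt0 exprn_egt1 // ltr1n.
Qed.

End Positivity.

(** * Taylor coefficients of the reflected product *)

Section GammaCoefficients.
Variable R : realType.
Implicit Types (q t x : R) (m k n : nat) (s : bool).
Local Notation Gamma := (@Gamma R).

Lemma cos_natmul_pihalf n :
  cos (n%:R * (pi / 2)) = (if odd n then 0 else (- 1) ^+ n./2) :> R.
Proof.
have even k : cos (k%:R * pi) = (- 1) ^+ k :> R /\ sin (k%:R * pi) = 0 :> R.
  elim: k => [|k [IHc IHs]]; first by rewrite mul0r cos0 sin0.
  by rewrite -[k.+1%:R]natr1 mulrDl mul1r cosDpi sinDpi IHc IHs exprS mulN1r oppr0.
rewrite -{1}[n]odd_double_half -muln2 natrD natrM mulrDl.
have -> : n./2%:R * 2 * (pi / 2) = n./2%:R * pi :> R by field.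
case: odd; last by rewrite mul0r add0r (even _).1.
by rewrite mul1r addrC cosDpihalf (even _).2 oppr0.
Qed.

(** Taylor coefficients at 0 of [cos t] and of [sin t / t]. *)
Definition trig_coef s n : rat :=
  if odd n then 0 else (if s then cos_coef _ n./2 else sinc_coef _ n./2).

Lemma cos_taylor_coef n :
  pi ^+ n / n`!%:R * cos (n%:R * (pi / 2)) = ratr (trig_coef true n) * pi ^+ n :> R.
Proof.
rewrite cos_natmul_pihalf /trig_coef; case: ifPn => [_|even_n].
  by rewrite rmorph0 mulr0 mul0r.
rewrite /cos_coef even_halfK // fmorph_div rmorphXn rmorphN1 rmorph_nat /=.
by rewrite mulrC mulrCA mulrC.
Qed.

Lemma sin_taylor_coef n :
  pi ^+ n.+1 / n.+1`!%:R * sin (n.+1%:R * (pi / 2)) =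
  pi * (ratr (trig_coef false n) * pi ^+ n) :> R.
Proof.
rewrite -[n.+1%:R]natr1 mulrDl mul1r sinDpihalf cos_natmul_pihalf /trig_coef.
case: ifPn => [_|even_n]; first by rewrite rmorph0 !mulr0 mul0r mulr0.
rewrite /sinc_coef even_halfK // fmorph_div rmorphXn rmorphN1 rmorph_nat /= exprS.
by move: (_^-1) => y; ring.
Qed.

(** Taylor coefficients at 0 of [Gamma (q + t) * Gamma (q - t)], given those of
    [Gamma (q + t)]. *)
Definition reflected (g : nat -> R) := cauchy_mul g (fun j => (- 1) ^+ j * g j).

(** [Gamma_product_relation] read on Taylor coefficients at 0. In the sine case the factor
    [pi t] common to both sides is cancelled, which leaves [kappa = 1]. *)
Lemma Gamma_coef_relation q e D : half_integer q -> ~ nonpositive_integer q ->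
  0 < e -> taylor_family e D -> (forall t, `|t| < e -> Gamma (q + t) = D 0 t) ->
  exists (a b : nat -> rat) (s : bool) (kappa : R),
  [/\ a 0%N != 0, b 0%N != 0, kappa != 0 & forall n,
    cauchy_mul (cauchy_mul (reflected (fun n => D n 0)) (fun n => ratr (a n)))
      (fun n => ratr (trig_coef s n) * pi ^+ n) n = kappa * ratr (b n)].
Proof.
move=> hq nq e0 TD GD; have [A [B [s [A0 B0 rel]]]] := Gamma_product_relation hq nq.
pose e1 := Num.min e 2^-1.
have e10 : 0 < e1 by rewrite lt_min e0 invr_gt0 /=.
have e1e : e1 <= e by rewrite ge_min lexx.
have e1h : e1 <= 2^-1 by rewrite ge_min lexx orbT.
have {}TD := taylor_family_le e1e TD.
pose p : {poly R} := pi *: ((if s then 1 else 'X) * map_poly ratr B).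
have coef_p n : p^`N(n).[0] = p`_n.
  by rewrite horner_coef0 coef_nderivn addn0 binn mulr1n.
have pos0 : `|0 : R| < e1 by rewrite normr0.
pose trig n t := pi ^+ n / n`!%:R *
  (if s then cos (pi * t + n%:R * (pi / 2)) else sin (pi * t + n%:R * (pi / 2))).
have Ttrig : taylor_family e1 trig.
  by rewrite /trig; case: s {rel p coef_p trig}; [exact: taylor_family_cos|exact: taylor_family_sin].
have TL := taylor_familyM (taylor_familyM (taylor_familyM TD (taylor_familyN TD))
  (taylor_family_poly (map_poly ratr A))) Ttrig.
have := taylor_family_uniq TL (taylor_family_poly p).
move=> /(_ _ _ _ pos0) E.
have {}E n : cauchy_mul (cauchy_mul (reflected (fun n => D n 0)) (fun n => ratr A`_n))
      (trig ^~ 0) n = p`_n.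
  rewrite -coef_p -E; last first.
    move=> t te; rewrite !big_ord1 !subnn /= nderivn0 /p /trig fact0 expr0 divr1.
    rewrite mul0r addr0 expr0 !mul1r -!GD ?(lt_le_trans _ e1e) ?normrN //.
    rewrite nderivn0 rel ?(lt_le_trans te) // hornerZ hornerM.
    by case: s {rel p coef_p trig Ttrig TL E}; rewrite ?hornerX ?hornerC ?mulrA.
  apply: eq_bigr => i _; congr (_ * _); apply: eq_bigr => j _; congr (_ * _).
    by apply: eq_bigr => l _; rewrite oppr0.
  by rewrite horner_coef0 coef_nderivn addn0 binn mulr1n coef_map.
exists (fun n => A`_n), (fun n => B`_n), s, (if s then pi else 1); split=> //.
  by case: (s); rewrite ?oner_eq0 // gt_eqF // pi_gt0.
move=> n; move: E; rewrite /trig /p; case: s {rel p coef_p trig Ttrig TL} => E.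
  rewrite -coef_map -coefZ -[map_poly _ _]mul1r -E; apply: eq_cauchy_mul => // j _.
  by rewrite mulr0 add0r cos_taylor_coef.
apply: (@mulfI _ pi); first by rewrite gt_eqF // pi_gt0.
have := E n.+1; rewrite coefZ coefXM /= coef_map /= mul1r => <-.
apply/esym/cauchy_mul_shift => [|j]; rewrite mulr0 add0r ?sin_taylor_coef //.
by rewrite mul0r sin0 mulr0.
Qed.

End GammaCoefficients.

(** The odd coefficients of [cos t] and [sin t / t] vanish, so the even coefficients of the
    inverse series invert the even ones. *)
Lemma trig_inv_coef_neq0 s (eps : nat -> rat) :
  (forall n, cauchy_mul eps (trig_coef s) n = cauchy_one _ n) ->
  forall k, eps k.*2 != 0.
Proof.
move=> epsP; have evenE k :
    cauchy_mul (fun j => eps j.*2) (fun j => trig_coef s j.*2) k = cauchy_one _ k.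
  have -> : cauchy_one rat k = cauchy_one _ k.*2 by rewrite /cauchy_one double_eq0.
  rewrite -epsP /cauchy_mul !big_ord_recr /=.
  rewrite (big_ord_parity k (fun i => eps i * trig_coef s (k.*2 - i)%N)) !subnn; congr (_ + _).
  apply: eq_bigr => j _; have jk := ltn_ord j.
  rewrite [X in _ + X](_ : _ = 0) ?addr0 ?doubleB // /trig_coef oddB ?odd_double /= ?odd_double.
    by rewrite mulr0.
  by rewrite ltn_double.
move=> k; rewrite gt_eqF //; move: k; case: s epsP evenE => epsP evenE.
  apply: (@sec_coef_gt0 _ (fun k => eps k.*2)) => n; rewrite -evenE.
  by apply: eq_cauchy_mul => // j _; rewrite /trig_coef odd_double doubleK.
apply: (@sinc_inv_coef_gt0 _ (fun k => eps k.*2)) => n; rewrite -evenE.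
by apply: eq_cauchy_mul => // j _; rewrite /trig_coef odd_double doubleK.
Qed.

Section LinearIndependence.
Variable R : realType.
Implicit Types (q t x : R) (m k n : nat).
Local Notation Gamma := (@Gamma R).

(** The relation of [Gamma_coef_relation] solved for the coefficients: the coefficient of
    index [n] is [kappa] times a polynomial of degree at most [n] in [pi], in which [pi^n] has
    the coefficient [beta 0 * eps n]. *)
Lemma reflected_expansion q e D : half_integer q -> ~ nonpositive_integer q ->
  0 < e -> taylor_family e D -> (forall t, `|t| < e -> Gamma (q + t) = D 0 t) ->
  exists (beta eps : nat -> rat) (kappa : R),
  [/\ beta 0%N != 0, (forall k, eps k.*2 != 0), kappa != 0 & forall n,
    reflected (fun n => D n 0) n =
    kappa * cauchy_mul (fun i => ratr (beta i)) (fun i => ratr (eps i) * pi ^+ i) n].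
Proof.
move=> hq nq e0 TD GD.
have [a [b [s [kappa [a0 b0 kappa0 rel]]]]] := Gamma_coef_relation hq nq e0 TD GD.
have [alpha alphaP] := cauchy_inv_exists a0.
have s0 : trig_coef s 0 != 0.
  rewrite /trig_coef /= /cos_coef /sinc_coef.
  by case: s {rel}; rewrite expr0 mul1r invr_eq0 pnatr_eq0.
have [eps epsP] := cauchy_inv_exists s0.
have ratr_one n : ratr (cauchy_one rat n) = cauchy_one R n by rewrite rmorph_nat.
have alphaR n : cauchy_mul (fun n => ratr (alpha n)) (fun n => ratr (a n)) n = cauchy_one R n.
  by rewrite -ratr_one -alphaP rmorph_cauchy_mul.
have epsR n : cauchy_mul (fun n => ratr (eps n) * pi ^+ n)
    (fun n => ratr (trig_coef s n) * pi ^+ n) n = cauchy_one R n.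
  rewrite cauchy_mul_scale.
  rewrite -(rmorph_cauchy_mul (ratr : {rmorphism rat -> R}) eps (trig_coef s)) /= epsP.
  by rewrite ratr_one /cauchy_one; case: n => [|n]; rewrite ?mulr1 ?mul0r.
exists (cauchy_mul b alpha), eps, kappa; split=> //.
- rewrite /cauchy_mul big_ord1 mulf_neq0 //.
  apply/eqP => alpha0; have := alphaP 0%N; rewrite /cauchy_mul big_ord1 alpha0 mul0r.
  by move/esym/eqP; rewrite oner_eq0.
- exact: trig_inv_coef_neq0 epsP.
move=> n; rewrite (cauchy_mul_cancel alphaR (cauchy_mul_cancel epsR rel)).
rewrite -cauchy_mulA (eq_cauchy_mul (f' := fun n => kappa * ratr (b n))
  (g' := cauchy_mul (fun n => ratr (alpha n)) (fun n => ratr (eps n) * pi ^+ n))) //; last first.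
  by move=> j _; rewrite cauchy_mulC.
rewrite cauchy_mulA (eq_cauchy_mul (f' := fun i => kappa * ratr (cauchy_mul b alpha i))
  (g' := fun n => ratr (eps n) * pi ^+ n)) // => [|j _].
  exact: cauchy_mulZl.
by rewrite (rmorph_cauchy_mul (ratr : {rmorphism rat -> R})) cauchy_mulZl.
Qed.

(** Since [pi] is transcendental and the coefficient of index [2 k] is, up to [kappa], a
    polynomial of degree exactly [2 k] in [pi], a relation with algebraic coefficients is a
    polynomial identity, in which the degrees are pairwise distinct. *)
Lemma reflected_independent q e D M (v : nat -> R) :
  half_integer q -> ~ nonpositive_integer q ->
  0 < e -> taylor_family e D -> (forall t, `|t| < e -> Gamma (q + t) = D 0 t) ->
  (forall k, algebraicOver (ratr : rat -> R) (v k)) ->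
  \sum_(k < M) v k * reflected (fun n => D n 0) k.*2 = 0 ->
  forall k, (k < M)%N -> v k = 0.
Proof.
move=> hq nq e0 TD GD alg_v.
have [beta [eps [kappa [beta0 eps0 kappa0 expand]]]] := reflected_expansion hq nq e0 TD GD.
pose Q n : {poly R} := \poly_(j < n.+1) ratr (beta (n - j)%N * eps j).
pose P m : {poly R} := \sum_(k < m) v k *: Q k.*2.
have QE n : reflected (fun n => D n 0) n = kappa * (Q n).[pi].
  rewrite expand cauchy_mulC horner_poly; congr (_ * _); apply: eq_bigr => j _.
  by rewrite rmorphM /= mulrC mulrA.
have P_alg m i : integralOver (ratr : rat -> R) (P m)`_i.
  rewrite coef_sum; elim/big_ind: _ => [|x y|k _]; first exact: mxpoly.integral0.
    exact: integral_add.
  rewrite coefZ coef_poly; apply: integral_mul; first exact/integral_algebraic.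
  by case: ifP => _; [exact: integral_id|exact: mxpoly.integral0].
move=> vM k kM; have {vM} : (P M).[pi] = 0.
  apply: (mulfI kappa0); rewrite mulr0 -[RHS]vM horner_sum mulr_sumr.
  by apply: eq_bigr => j _; rewrite hornerZ QE mulrCA.
have [P0 _|Pn0 Ppi] := eqVneq (P M) 0; last first.
  case: (@pi_transcendental R); apply/integral_algebraic.
  apply: (integral_root Pn0); first exact/eqP.
  exact/integral_poly.
elim: M P0 kM => // M IHM; rewrite /P big_ord_recr /= => PM.
(* in degree [2 M] only the last polynomial contributes *)
have vM0 : v M = 0.
  have := congr1 (fun p : {poly R} => p`_M.*2) PM.
  rewrite coefD coef_sum big1 => [|j _]; last first.
    by rewrite coefZ coef_poly ltnS leq_double leqNgt ltn_ord mulr0.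
  rewrite add0r coefZ coef_poly ltnSn subnn coef0 => /eqP.
  by rewrite mulf_eq0 fmorph_eq0 mulf_eq0 (negPf beta0) (negPf (eps0 M)) !orbF => /eqP.
rewrite vM0 scale0r addr0 in PM; rewrite ltnS leq_eqVlt => /orP[/eqP->//|].
exact: IHM.
Qed.

End LinearIndependence.

(** * Quadratic relations and counting *)

(** The field of algebraic reals as a subfield of [R], so that the linear algebra below can be
    done over it. *)
Section AlgebraicReals.
Variable R : realType.

Definition algebraic : {pred R} := fun x => `[< algebraicOver (ratr : rat -> R) x >].

Lemma algebraicP x : reflect (algebraicOver (ratr : rat -> R) x) (x \in algebraic).
Proof. exact: asboolP. Qed.

Lemma algebraic_divring_closed : divring_closed algebraic.
Proof.
split=> [|x y /algebraicP ax /algebraicP ay|x y /algebraicP ax /algebraicP ay]; apply/algebraicP.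
- exact: algebraic1.
- exact: algebraic_sub.
- exact: algebraic_div.
Qed.

HB.instance Definition _ := GRing.isDivringClosed.Build R algebraic algebraic_divring_closed.

Record algReal := AlgReal { algReal_val :> R; algReal_valP : algReal_val \in algebraic }.
HB.instance Definition _ := [isSub for algReal_val].
HB.instance Definition _ := [Choice of algReal by <:].
HB.instance Definition _ := [SubChoice_isSubIntegralDomain of algReal by <:].
HB.instance Definition _ := [SubIntegralDomain_isSubField of algReal by <:].

End AlgebraicReals.

(** There is one homogeneous linear equation for each unordered pair of indices, hence fewer
    equations than unknowns. *)
Lemma quadratic_forms_dependent (K : fieldType) n m (mu : 'I_m -> 'I_n -> 'I_n -> K) :
  ('C(n.+1, 2) < m)%N -> exists2 v : 'rV[K]_m, v != 0 &
    forall a b, \sum_k v 0 k * (mu k a b + mu k b a) = 0.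
Proof.
move=> nm; pose P := [set p : 'I_n * 'I_n | (p.2 <= p.1)%N]%SET.
have cardP : #|P| = 'C(n.+1, 2).
  rewrite -sum1dep_card.
  rewrite -(pair_big_dep xpredT (fun a b : 'I_n => (b <= a)%N) (fun _ _ => 1%N)) /=.
  rewrite -bin2_sum big_mkord big_ord_recl add0n; apply: eq_bigr => a _.
  by rewrite -(big_ord_widen _ (fun=> 1%N) (ltn_ord a)) sum1_card card_ord.
pose A := \matrix_(k < m, c < #|P|)
  (mu k (enum_val c).1 (enum_val c).2 + mu k (enum_val c).2 (enum_val c).1).
have : kermx A != 0.
  rewrite kermx_eq0 /row_free neq_ltn; apply/orP; left.
  by rewrite (leq_ltn_trans (rank_leq_col _)) // cardP.
case/rowV0Pn => v /sub_kermxP vA v0; exists v => // a b.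
wlog ab : a b / (b <= a)%N.
  move=> H; have [/H//|/ltnW/H vba] := leqP b a; rewrite -[RHS]vba.
  by apply: eq_bigr => k _; rewrite addrC.
have abP : (a, b) \in P by rewrite inE.
have /rowP/(_ (enum_rank_in abP (a, b))) := vA; rewrite !mxE => vab.
rewrite -[RHS]vab; apply: eq_bigr => k _.
by rewrite mxE enum_rankK_in.
Qed.

(** If [s] of the numbers [g 1, ..., g N] are transcendental, then together
    with 1 and [g 0] they span all [g j] over the algebraic numbers, so the [N / 2 + 1]
    quadratic expressions lie in a space of dimension [(s + 2) (s + 3) / 2]. *)
Lemma transcendental_count (R : realType) (g : nat -> R) N (S : {set 'I_N.+1}) :
  (forall j : 'I_N.+1, (0 < j)%N -> j \notin S -> algebraicOver (ratr : rat -> R) (g j)) ->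
  (forall v : nat -> R, (forall k, algebraicOver (ratr : rat -> R) (v k)) ->
     \sum_(k < (N %/ 2).+1) v k * cauchy_mul g (fun j => (- 1) ^+ j * g j) k.*2 = 0 ->
     forall k, (k <= N %/ 2)%N -> v k = 0) ->
  (N %/ 2 < 'C(#|S|.+3, 2))%N.
Proof.
move=> alg_g indep; rewrite ltnNge; apply/negP => many.
pose T := (ord0 |: S)%SET.
pose w (a : 'I_#|T|.+1) := if unlift ord0 a is Some r then g (enum_val r) else 1.
have span (j : 'I_N.+1) : exists c : 'I_#|T|.+1 -> algReal R, g j = \sum_a (c a : R) * w a.
  have [jT|] := boolP (j \in T).
    exists (fun a => (a == lift ord0 (enum_rank_in jT j))%:R).
    rewrite (bigD1 (lift ord0 (enum_rank_in jT j))) //= eqxx mul1r big1 ?addr0.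
      by rewrite /w liftK enum_rankK_in.
    by move=> a /negPf ->; rewrite mul0r.
  rewrite !inE negb_or => /andP[j0 jS].
  have /algebraicP gj : algebraicOver (ratr : rat -> R) (g j).
    by apply: alg_g; rewrite // lt0n.
  exists (fun a => if a == ord0 then AlgReal gj else 0).
  rewrite big_ord_recl eqxx /w unlift_none mulr1 big1 ?addr0 // => a _.
  by rewrite /= mul0r.
have [c cP] := fin_all_exists span.
have gE j : (j <= N)%N -> g j = \sum_a (c (inord j) a : R) * w a.
  by move=> jN; rewrite -cP inordK.
pose mu (k : 'I_(N %/ 2).+1) a b := \sum_(j < k.*2.+1)
  (- 1) ^+ (k.*2 - j) * c (inord j) a * c (inord (k.*2 - j)) b.
have gg (k : 'I_(N %/ 2).+1) : cauchy_mul g (fun j => (- 1) ^+ j * g j) k.*2 =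
    \sum_a \sum_b (mu k a b : R) * w a * w b.
  have k2N : (k.*2 <= N)%N.
    by rewrite -muln2 (leq_trans _ (leq_trunc_div N 2)) // leq_mul2r /= -ltnS.
  have muR a b : (mu k a b : R) = \sum_(j < k.*2.+1)
      (- 1) ^+ (k.*2 - j) * (c (inord j) a : R) * (c (inord (k.*2 - j)) b : R).
    rewrite -[LHS]/(\val (mu k a b)) rmorph_sum; apply: eq_bigr => j _.
    by rewrite !rmorphM rmorphXn rmorphN1.
  rewrite exchange_big /=.
  under eq_bigr do under eq_bigr do rewrite muR !mulr_suml.
  rewrite exchange_big /=.
  under eq_bigr do rewrite exchange_big /=.
  rewrite exchange_big /=; apply: eq_bigr => j _.
  rewrite !gE ?(leq_trans (leq_subr _ _)) ?(leq_trans _ k2N) -1?ltnS //.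
  rewrite mulr_suml; apply: eq_bigr => a _.
  rewrite mulr_sumr mulr_sumr; apply: eq_bigr => b _; ring.
have [|v v0 vP] := quadratic_forms_dependent mu.
  rewrite ltnS (leq_trans _ many) // leq_bin2l // !ltnS.
  by rewrite cardsU1; case: (_ \notin _).
pose v' k := if (k < (N %/ 2).+1)%N then (v 0 (inord k) : R) else 0.
case/negP: v0; apply/eqP/rowP => k; rewrite mxE; apply: val_inj => /=.
have -> : (v 0 k : R) = v' k by rewrite /v' ltn_ord inord_val.
apply: (indep v'); last by rewrite -ltnS.
  move=> i; apply/algebraicP; rewrite /v'; case: ifP => _; last exact: rpred0.
  exact: algReal_valP.
(* doubling makes the quadratic forms appear through their symmetrised coefficients *)
apply/eqP; rewrite -[_ == 0](mulrn_eq0 _ 2); apply/eqP.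
have double (i : 'I_(N %/ 2).+1) : cauchy_mul g (fun j => (- 1) ^+ j * g j) i.*2 *+ 2 =
    \sum_a \sum_b ((mu i a b : R) + (mu i b a : R)) * w a * w b.
  rewrite mulr2n (gg i) {2}exchange_big /= -big_split; apply: eq_bigr => a _.
  by rewrite -big_split; apply: eq_bigr => b _ /=; ring.
rewrite -sumrMnl (eq_bigr (fun i : 'I_(N %/ 2).+1 => \sum_a \sum_b
  (v 0 i : R) * ((mu i a b : R) + (mu i b a : R)) * w a * w b)); last first.
  move=> i _; rewrite -mulrnAr double /v' ltn_ord inord_val mulr_sumr.
  by apply: eq_bigr => a _; rewrite mulr_sumr; apply: eq_bigr => b _; rewrite !mulrA.
rewrite exchange_big big1 //= => a _; rewrite exchange_big big1 //= => b _.
rewrite -!mulr_suml; have /(congr1 \val) := vP a b.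
rewrite rmorph_sum /= => ->; by rewrite !mul0r.
Qed.

(** * The lower bound and its order of magnitude *)

Section Asymptotics.
Variable R : realType.

(** The constants 1/2 and 1 are valid as soon as [sqrt N >= 5]. *)
Lemma beta_asymp : asymp (beta R) (fun N : nat => N%:R `^ (- (1 / 2))).
Proof.
exists (1 / 2), 1; split; [lra|lra|exists 25%N => // N /= N25].
have N0 : 0 < N%:R :> R by rewrite ltr0n (leq_trans _ N25).
have sqrtN0 : 0 < Num.sqrt N%:R :> R by rewrite sqrtr_gt0.
have sqrtN5 : 5 <= Num.sqrt N%:R :> R.
  rewrite (le_trans _ (@ler_wsqrtr _ (5 ^+ 2) _ _)) ?sqrtr_sqr ?ger0_norm //.
  by rewrite -natrX ler_nat.
have -> : N%:R `^ (- (1 / 2)) = Num.sqrt N%:R / N%:R :> R.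
  rewrite powRN mul1r powR12_sqrt //.
  by rewrite -[X in _ / X](sqr_sqrtr (ltW N0)) expr2 invfM mulrA divff ?mul1r ?gt_eqF.
rewrite /beta max_r; last by lra.
by rewrite !mulrA !ler_pM2r ?invr_gt0 // mul1r; split; lra.
Qed.

(** With [x = s], the hypothesis is [2 m + 2 <= (x + 3) (x + 2)], that is
    [2 m + 9 / 4 <= (x + 5 / 2)^2]. *)
Lemma ceil_bound (m s : nat) : (m < 'C(s.+3, 2))%N ->
  Num.max 0 (Num.ceil (Num.sqrt (2 * m%:R + 9 / 4) - 5 / 2 : R)) <= s%:Z.
Proof.
rewrite ge_max /= => ms; rewrite Num.Theory.ceil_le_int.
have : (2 * m.+1 <= s.+3 * s.+2)%N.
  have := mul_bin_diag s.+3 1; rewrite bin1 => ->; exact: leq_mul.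
rewrite -(ler_nat R) !natrM -[m.+1%:R]natr1 -[s.+3%:R]natr1 -[s.+2%:R]natr1 -[s.+1%:R]natr1.
have s0 : 0 <= s%:R :> R by rewrite ler0n.
move=> ms2; rewrite lerBlDr -[leRHS]ger0_norm -?sqrtr_sqr; last by rewrite addr_ge0.
by rewrite ler_wsqrtr // -[s%:~R]/(s%:R); nra.
Qed.

(** [2 (N / 2) + 9 / 4 >= N], because the integer quotient loses at most one half. *)
Lemma ceil_ge_sqrt (N : nat) :
  Num.max 0 (Num.sqrt N%:R - 5 / 2 : R) <=
  (Num.max 0 (Num.ceil (Num.sqrt (2 * (N %/ 2)%N%:R + 9 / 4) - 5 / 2 : R)))%:~R.
Proof.
have max_ge (z : int) : z%:~R <= (Num.max 0 z)%:~R :> R by rewrite ler_int le_max lexx orbT.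
rewrite ge_max; apply/andP; split; first by rewrite ler0z le_max lexx.
apply: le_trans (max_ge _); apply: le_trans (Num.Theory.ceil_ge _).
rewrite lerB // ler_wsqrtr //.
have : (N <= 2 * (N %/ 2) + 1)%N.
  by rewrite {1}(divn_eq N 2) mulnC leq_add2l -ltnS ltn_pmod.
by rewrite -(ler_nat R) natrD natrM; lra.
Qed.

End Asymptotics.

Theorem theorem2 (R : realType) :
  (forall (q : R) (N : nat),
     half_integer q -> ~ nonpositive_integer q -> (1 <= N)%N ->
     let m : int :=
       Num.max 0 (Num.ceil (Num.sqrt (2 * (N %/ 2)%N%:R + 9 / 4) - 5 / 2 : R)) in
     delta q N >= m%:~R / N%:R /\ m%:~R / N%:R >= beta R N)
  /\ asymp (beta R) (fun N : nat => N%:R `^ (- (1 / 2))).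
Proof.
split; last exact: beta_asymp.
move=> q N hq nq N0 m; have N0R : 0 < N%:R^-1 :> R by rewrite invr_gt0 ltr0n.
split; last by rewrite /beta ler_pM2r // ceil_ge_sqrt.
rewrite /delta; set S := [set _ | _]%SET; rewrite ler_pM2r // -[#|S|%:R]/((#|S| : int)%:~R) ler_int.
apply: ceil_bound.
have [e [D [e0 TD GD]]] := Gamma_taylor_family hq nq.
have derivE n : derive1n n (@Gamma R) q = n`!%:R * D n 0.
  by rewrite -[q]addr0 (derive1n_taylor_family _ TD GD) // normr0.
apply: (@transcendental_count _ (fun n => D n 0)).
  move=> j j0; rewrite inE j0 /= => /asboolPn; rewrite /transcendental derivE => /contrapT alg.
  have -> : D j 0 = (j`!%:R * D j 0) / j`!%:R.
    by rewrite mulrC mulKf // pnatr_eq0 -lt0n fact_gt0.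
  apply: algebraic_div alg _; apply/integral_algebraic; exact: integral_nat.
move=> v alg_v vN k kN; apply: (reflected_independent hq nq e0 TD GD alg_v vN).
by rewrite ltnS.
Qed.
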